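(* $\textsf{VCh-rf}$ can be solved in time $O(n)$ on instances in which every channel is synchronous (capacity $0$), regardless of the number of threads.
   Context: Channels and events. Each channel $\mathtt{ch}$ has a capacity $\mathsf{cap}(\mathtt{ch})\in\mathbb{N}$; $\mathtt{ch}$ is synchronous if $\mathsf{cap}(\mathtt{ch})=0$ and asynchronous otherwise. An event is a tuple $e=\langle id,\tau,\mathsf{op}(\mathtt{ch},\mathsf{val})\rangle$ with a unique identifier $id$, a thread $\tau$, an operation $\mathsf{op}\in\{\mathtt{snd},\mathtt{rcv}\}$, a channel $\mathtt{ch}$ and a value $\mathsf{val}$. An execution is a finite sequence $\sigma$ of distinct events. $\sigma$ is well-formed (w.r.t. $\mathsf{cap}$) if: (i) for every asynchronous $\mathtt{ch}$ and every prefix $\pi$ of $\sigma$, $R_\pi(\mathtt{ch})\le S_\pi(\mathtt{ch})\le R_\pi(\mathtt{ch})+\mathsf{cap}(\mathtt{ch})$, where $S_\pi(\mathtt{ch})$, $R_\pi(\mathtt{ch})$ are the numbers of send, resp. receive, events on $\mathtt{ch}$ in $\pi$; (ii) for every synchronous $\mathtt{ch}$, every send on $\mathtt{ch}$ is immediately followed in $\sigma$ by a receive on $\mathtt{ch}$ of a different thread, and every receive on $\mathtt{ch}$ is immediately preceded in $\sigma$ by a send on $\mathtt{ch}$ of a different thread; (iii) for every channel $\mathtt{ch}$ and every $i$, if $\sigma$ contains an $i$-th receive on $\mathtt{ch}$, then the $i$-th send on $\mathtt{ch}$ has the same value as it. The program order $\mathsf{po}_\sigma$ is the set of pairs $(e,f)$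 with $e$ before $f$ in $\sigma$ and in the same thread; the reads-from relation $\mathsf{rf}_\sigma$ is the set of pairs $(s,r)$ such that for some channel $\mathtt{ch}$ and some $i$, $s$ is the $i$-th send and $r$ the $i$-th receive on $\mathtt{ch}$ in $\sigma$. An abstract execution is $\mathcal{X}=\langle \mathsf{S},\mathsf{po}\rangle$ where $\mathsf{S}$ is a finite set of events and $\mathsf{po}$ is a strict order that totally orders the events of each thread and relates no events of different threads. Given a capacity function $\mathsf{cap}$ on the channels occurring in $\mathsf{S}$, an execution $\sigma$ concretizes $\langle\mathcal{X},\mathsf{cap}\rangle$ if its set of events is $\mathsf{S}$, $\mathsf{po}_\sigma=\mathsf{po}$ and $\sigma$ is well-formed; $\langle\mathcal{X},\mathsf{cap}\rangle$ is consistent if it has a concretization. The problem $\textsf{VCh}$: given $\langle\mathcal{X},\mathsf{cap}\rangle$, decide whether it is consistent. An instance of $\textsf{VCh-rf}$ is $\langle\mathcal{X},\mathsf{cap},\mathsf{rf}\rangle$ where additionally $\mathsf{rf}$ is a set of pairs $(s,r)$ of a send and a receive event of $\mathsf{S}$ on the same channel; it is consistent if some concretization $\sigma$ of $\langle\mathcal{X},\mathsf{cap}\rangle$ satisfies $\mathsf{rf}_\sigma=\mathsf{rf}$. Parameters: $n=|\mathsf{S}|$, $t$ = number of threads, $m$ = number of channels occurring in $\mathsf{S}$, $k=\max_{\mathtt{ch}}\mathsf{cap}(\mathtt{ch})$. A channel $\mathtt{ch}$ is called capacity-unbounded (in $\mathcal{X}$) if $\mathsf{S}$ contains at most $\mathsf{cap}(\mathtt{ch})$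 send events on $\mathtt{ch}$. *)

(* Defs.v *)
From HB Require Import structures.
From mathcomp Require Import all_boot.
Set Implicit Arguments. Unset Strict Implicit. Unset Printing Implicit Defensive.

Record event := Event {
  eid : nat;
  thr : nat;
  is_snd : bool;
  chan : nat;
  value : nat
}.

Definition event_tuple (e : event) := (eid e, thr e, is_snd e, chan e, value e).
Definition tuple_event (t : nat * nat * bool * nat * nat) :=
  let: (a, b, c, d, f) := t in Event a b c d f.
Lemma event_tupleK : cancel event_tuple tuple_event. Proof. by case. Qed.
HB.instance Definition _ := Countable.copy event (can_type event_tupleK).

Definition e0 : event := Event 0 0 false 0 0.

Definition sends (ch : nat) (s : seq event) :=
  [seq e <- s | is_snd e && (chan e == ch)].
Definition rcvs (ch : nat) (s : seq event) :=
  [seq e <- s | ~~ is_snd e && (chan e == ch)].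

Definition well_formed (cap : nat -> nat) (sigma : seq event) : Prop :=
  uniq sigma /\
  (forall ch, 0 < cap ch -> forall k, k <= size sigma ->
     size (rcvs ch (take k sigma)) <= size (sends ch (take k sigma))
       <= size (rcvs ch (take k sigma)) + cap ch) /\
  (forall ch, cap ch = 0 -> forall i, i < size sigma ->
     let e := nth e0 sigma i in
     (is_snd e /\ chan e = ch ->
        i.+1 < size sigma /\
        let f := nth e0 sigma i.+1 in
        ~~ is_snd f /\ chan f = ch /\ thr f <> thr e) /\
     (~~ is_snd e /\ chan e = ch ->
        0 < i /\
        let f := nth e0 sigma i.-1 in
        is_snd f /\ chan f = ch /\ thr f <> thr e)) /\
  (forall ch i, i < size (rcvs ch sigma) ->
     i < size (sends ch sigma) /\
     value (nth e0 (sends ch sigma) i) = value (nth e0 (rcvs ch sigma) i)).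

Definition po_of (sigma : seq event) : rel event :=
  fun e f => [&& e \in sigma, f \in sigma, thr e == thr f &
                 index e sigma < index f sigma].

Definition rf_of (sigma : seq event) (s r : event) : Prop :=
  exists ch i, [/\ i < size (sends ch sigma), i < size (rcvs ch sigma),
                   s = nth e0 (sends ch sigma) i &
                   r = nth e0 (rcvs ch sigma) i].

Definition abstract_execution (S : seq event) (po : rel event) : Prop :=
  [/\ uniq S, uniq (map eid S),
      (forall e f, po e f -> [/\ e \in S, f \in S & thr e = thr f]),
      irreflexive po /\ transitive po &
      (forall e f, e \in S -> f \in S -> thr e = thr f -> e <> f ->
         po e f \/ po f e)].

Definition rf_instance (S : seq event) (rf : seq (event * event)) : Prop :=
  uniq rf /\
  (forall p, p \in rf ->
     [/\ p.1 \in S, p.2 \in S, is_snd p.1, ~~ is_snd p.2 & chan p.1 = chan p.2]).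

Definition concretizes (cap : nat -> nat) (S : seq event) (po : rel event)
    (sigma : seq event) : Prop :=
  [/\ perm_eq sigma S, (forall e f, po_of sigma e f = po e f) &
      well_formed cap sigma].

Definition consistent_rf (cap : nat -> nat) (S : seq event) (po : rel event)
    (rf : seq (event * event)) : Prop :=
  exists sigma, concretizes cap S po sigma /\
    (forall s r, (s, r) \in rf <-> rf_of sigma s r).

Definition cap_sync : nat -> nat := fun _ => 0.

Inductive instr :=
| ICst   (d c : nat)
| IAdd   (a b d : nat)
| ISub   (a b d : nat)
| ILoad  (a d : nat)
| IStore (a s : nat)
| IJz    (a l : nat)
| IHalt.

Definition config := (nat * (nat -> nat))%type.

Definition upd (M : nat -> nat) (d v : nat) : nat -> nat :=
  fun x => if x == d then v else M x.

Definition step (P : seq instr) (c : config) : config :=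
  let: (pc, M) := c in
  match nth IHalt P pc with
  | ICst d k => (pc.+1, upd M d k)
  | IAdd a b d => (pc.+1, upd M d (M a + M b))
  | ISub a b d => (pc.+1, upd M d (M a - M b))
  | ILoad a d => (pc.+1, upd M d (M (M a)))
  | IStore a s => (pc.+1, upd M (M a) (M s))
  | IJz a l => if M a == 0 then (l, M) else (pc.+1, M)
  | IHalt => (pc, M)
  end.

Definition halted (P : seq instr) (c : config) : bool :=
  if nth IHalt P c.1 is IHalt then true else false.

Definition init_mem (input : seq nat) : nat -> nat := fun a => nth 0 input a.

Definition run (P : seq instr) (input : seq nat) (t : nat) : config :=
  iter t (step P) (0, init_mem input).

Definition accepts (c : config) : Prop := c.2 0 <> 0.

Definition po_rank (S : seq event) (po : rel event) (e : event) : nat :=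
  count (fun f => po f e) S.

Definition encodes (S : seq event) (po : rel event) (rf : seq (event * event))
    (input : seq nat) : Prop :=
  exists (ord : seq event) (tn cn : nat -> nat),
    [/\ perm_eq ord S,
        {in S &, forall e f, (tn (thr e) == tn (thr f)) = (thr e == thr f)},
        {in S &, forall e f, (cn (chan e) == cn (chan f)) = (chan e == chan f)},
        {in S, forall e, tn (thr e) < size S /\ cn (chan e) < size S} &
        input =
          [:: size S; size rf]
          ++ flatten [seq [:: tn (thr e); nat_of_bool (is_snd e); cn (chan e);
                             value e; po_rank S po e] | e <- ord]
          ++ flatten [seq [:: index p.1 ord; index p.2 ord] | p <- rf]].

(* Main.v *)
Require Import Defs.
From mathcomp Require Import all_boot zify.
Set Implicit Arguments. Unset Strict Implicit. Unset Printing Implicit Defensive.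

(** When every channel is synchronous, an execution is well-formed iff it is a
    sequence of blocks "send, matching receive" whose two events belong to
    different threads and carry equal values, and the reads-from relation is
    then the set of blocks.  Hence the instance is consistent iff [rf] is a
    perfect matching of [S] by admissible pairs and the pairs can be ordered
    compatibly with the program order.

    The last condition is a topological sort.  A queue initially holds the first
    event of every thread.  Events are dequeued one at a time; when the partner
    of the dequeued event has been dequeued as well, the pair fires and the
    thread successors of both events are enqueued.  The instance is consistent
    iff every event gets enqueued: sorting the pairs by firing time yields an
    execution, and conversely the first event of an execution never enqueued
    would have a predecessor whose pair has fired.

    The successor of an event in its thread is read off a sparse table indexed
    by (thread, rank); memory cells start at 0, so the table costs only one
    write per event although it spans quadratically many addresses. *)

(** * Structured programs and their compilation *)

Inductive cmd :=
| Cst   (d v : nat)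
| Add   (a b d : nat)
| Sub   (a b d : nat)
| Read  (a d : nat)
| Write (a s : nat)
| Seq   (c1 c2 : cmd)
| When  (a : nat) (c : cmd)
| While (a : nat) (c : cmd).

Notation "c1 ;; c2" := (Seq c1 c2) (at level 90, right associativity).

Definition nreg := 18.
(* This register must hold 0 at the end of every loop body: the jump back tests it. *)
Definition zreg := 14.

Fixpoint csize (c : cmd) : nat :=
  match c with
  | Seq c1 c2 => csize c1 + csize c2
  | When _ b => (csize b).+1
  | While _ b => (csize b).+2
  | _ => 1
  end.

Fixpoint compile (pc : nat) (c : cmd) : seq instr :=
  match c with
  | Cst d v => [:: ICst d v]
  | Add a b d => [:: IAdd a b d]
  | Sub a b d => [:: ISub a b d]
  | Read a d => [:: ILoad a d]
  | Write a s => [:: IStore a s]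
  | Seq c1 c2 => compile pc c1 ++ compile (pc + csize c1) c2
  | When a b => IJz a (pc + (csize b).+1) :: compile pc.+1 b
  | While a b => IJz a (pc + (csize b).+2) :: rcons (compile pc.+1 b) (IJz zreg pc)
  end.

Fixpoint wf_cmd (c : cmd) : bool :=
  match c with
  | Cst d _ => d < nreg
  | Add a b d | Sub a b d => [&& a < nreg, b < nreg & d < nreg]
  | Read a d => (a < nreg) && (d < nreg)
  | Write a s => (a < nreg) && (s < nreg)
  | Seq c1 c2 => wf_cmd c1 && wf_cmd c2
  | When a b | While a b => (a < nreg) && wf_cmd b
  end.

(** One bound [N] serves for all loops. Each iteration pays two steps for the test and the jump
    back, and the final failing test pays one more. The program below nests no loops, so its cost is
    linear in [N]. *)
Fixpoint cost (N : nat) (c : cmd) : nat :=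
  match c with
  | Seq c1 c2 => cost N c1 + cost N c2
  | When _ b => (cost N b).+1
  | While _ b => (N * (cost N b).+2).+1
  | _ => 1
  end.

(* The memory is split at [nreg] into a register file [R] and a heap [H], so
   that register accesses compute and only heap accesses need reasoning. *)
Definition represents (M : nat -> nat) (R : seq nat) (H : nat -> nat) :=
  forall a, M a = if a < nreg then nth 0 R a else H a.

(* Weakest precondition for termination in a state satisfying [Q], where no
   loop makes more than [N] iterations. *)
Fixpoint wp (N : nat) (c : cmd) (Q : seq nat -> (nat -> nat) -> Prop)
    (R : seq nat) (H : nat -> nat) : Prop :=
  match c with
  | Cst d v => Q (set_nth 0 R d v) H
  | Add a b d => Q (set_nth 0 R d (nth 0 R a + nth 0 R b)) H
  | Sub a b d => Q (set_nth 0 R d (nth 0 R a - nth 0 R b)) H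
  | Read a d => nreg <= nth 0 R a /\ Q (set_nth 0 R d (H (nth 0 R a))) H
  | Write a s => nreg <= nth 0 R a /\ Q R (upd H (nth 0 R a) (nth 0 R s))
  | Seq c1 c2 => wp N c1 (wp N c2 Q) R H
  | When a b => (nth 0 R a = 0 -> Q R H) /\ (nth 0 R a <> 0 -> wp N b Q R H)
  | While a b =>
      exists2 k, k <= N &
      (fix loop k R H {struct k} := match k with
       | 0 => nth 0 R a = 0 /\ Q R H
       | k'.+1 => nth 0 R a <> 0 /\
           wp N b (fun R' H' => nth 0 R' zreg = 0 /\ loop k' R' H') R H
       end) k R H
  end.

Lemma wp_mono N c (Q Q' : seq nat -> (nat -> nat) -> Prop) R H :
  (forall R' H', Q R' H' -> Q' R' H') -> wp N c Q R H -> wp N c Q' R H.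
Proof.
elim: c Q Q' R H => /=; try by move=> *; intuition.
- by move=> c1 IH1 c2 IH2 Q Q' R H QQ'; apply: IH1 => R' H'; exact: IH2.
- by move=> a b IH Q Q' R H QQ' [? Hb]; split; [auto|move=> /Hb; exact: IH].
move=> a b IH Q Q' R H QQ' [k kN Hk]; exists k => //.
elim: k R H {kN} Hk => [|k IHk] R H [Ra Hk]; split=> //; first exact: QQ'.
by apply: IH Hk => R' H' [Rz Hl]; split=> //; exact: IHk.
Qed.

(** The invariant is indexed by the number of iterations already made. Fixing their total [k]
    beforehand gives termination and the time bound at once. *)
Lemma wp_while N a b (I : nat -> seq nat -> (nat -> nat) -> Prop) Q k R H :
    k <= N -> I 0 R H ->
    (forall i R' H', i < k -> I i R' H' -> nth 0 R' a <> 0 /\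
       wp N b (fun R'' H'' => nth 0 R'' zreg = 0 /\ I i.+1 R'' H'') R' H') ->
    (forall R' H', I k R' H' -> nth 0 R' a = 0 /\ Q R' H') ->
  wp N (While a b) Q R H.
Proof.
move=> kN I0 Istep Iend /=; exists k => //.
set loop := (X in X k R H).
(* [loop] counts the remaining iterations while [I] counts the past ones, hence the index
   [k - j]. *)
suff: forall j R' H', j <= k -> I (k - j) R' H' -> loop j R' H'.
  by apply=> //; rewrite subnn.
elim=> [|j IHj] R' H' jk; first by rewrite subn0 => /Iend.
move=> /Istep; rewrite ltn_subrL (leq_trans _ jk) // => /(_ isT) [Ra Hb].
split=> //; apply: wp_mono Hb => R'' H'' [Rz Ij]; split=> //.
by apply: IHj; [exact: ltnW | rewrite subnSK in Ij].
Qed.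

Lemma size_compile pc c : size (compile pc c) = csize c.
Proof.
elim: c pc => //= [c1 IH1 c2 IH2|a b IH|a b IH] pc.
- by rewrite size_cat IH1 IH2.
- by rewrite IH.
- by rewrite size_rcons IH.
Qed.

Lemma represents_set M R H d v : d < nreg ->
  represents M R H -> represents (upd M d v) (set_nth 0 R d v) H.
Proof.
move=> dK MR a; rewrite /upd nth_set_nth /=.
by case: eqP => [->|_]; rewrite ?dK.
Qed.

Lemma represents_upd M R H d v : nreg <= d ->
  represents M R H -> represents (upd M d v) R (upd H d v).
Proof.
move=> dK MR a; rewrite /upd.
by case: eqP => [->|_]; rewrite ?MR // ltnNge dK.
Qed.

Lemma nth_code pre (i : instr) post : nth IHalt (pre ++ i :: post) (size pre) = i.
Proof. by rewrite nth_cat ltnn subnn. Qed.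

(** Jump targets are absolute, so the code is compiled for its position inside an arbitrary context;
    the induction hands the neighbouring code over to [pre] and [post]. *)
Lemma wp_sound N c pre post Q R H M :
    wf_cmd c -> represents M R H -> wp N c Q R H ->
  exists t M' R' H', [/\ t <= cost N c,
    iter t (step (pre ++ compile (size pre) c ++ post)) (size pre, M)
      = (size pre + csize c, M'),
    represents M' R' H' & Q R' H'].
Proof.
elim: c pre post Q R H M => /=.
- move=> d v pre post Q R H M dK MR HQ.
  exists 1, (upd M d v), (set_nth 0 R d v), H; split=> //.
    by rewrite /= nth_code addn1.
  exact: represents_set.
- move=> a b d pre post Q R H M /and3P[aK bK dK] MR HQ.
  exists 1, (upd M d (M a + M b)), (set_nth 0 R d (nth 0 R a + nth 0 R b)), H.
  split=> //; first by rewrite /= nth_code addn1.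
  by rewrite !MR aK bK; exact: represents_set.
- move=> a b d pre post Q R H M /and3P[aK bK dK] MR HQ.
  exists 1, (upd M d (M a - M b)), (set_nth 0 R d (nth 0 R a - nth 0 R b)), H.
  split=> //; first by rewrite /= nth_code addn1.
  by rewrite !MR aK bK; exact: represents_set.
- move=> a d pre post Q R H M /andP[aK dK] MR [Ra HQ].
  exists 1, (upd M d (M (M a))), (set_nth 0 R d (H (nth 0 R a))), H.
  split=> //; first by rewrite /= nth_code addn1.
  by rewrite (MR a) aK (MR (nth 0 R a)) ltnNge Ra; exact: represents_set.
- move=> a s pre post Q R H M /andP[aK sK] MR [Ra HQ].
  exists 1, (upd M (M a) (M s)), R, (upd H (nth 0 R a) (nth 0 R s)).
  split=> //; first by rewrite /= nth_code addn1.
  by rewrite !MR aK sK; exact: represents_upd.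
- move=> c1 IH1 c2 IH2 pre post Q R H M /andP[w1 w2] MR.
  move=> /(IH1 pre (compile (size pre + csize c1) c2 ++ post) _ _ _ _ w1 MR).
  move=> [t1 [M1 [R1 [H1 [b1 e1 MR1]]]]].
  move=> /(IH2 (pre ++ compile (size pre) c1) post _ _ _ _ w2 MR1).
  move=> [t2 [M2 [R2 [H2 [b2 e2 MR2 HQ]]]]].
  exists (t2 + t1), M2, R2, H2; split=> //; first by rewrite addnC leq_add.
  rewrite iterD -catA e1; move: e2.
  by rewrite size_cat size_compile -!catA addnA.
- move=> a b IH pre post Q R H M /andP[aK wb] MR [H0 H1].
  have step1 : step (pre ++ (IJz a (size pre + (csize b).+1) ::
      compile (size pre).+1 b) ++ post) (size pre, M) =
      if nth 0 R a == 0 then (size pre + (csize b).+1, M) else ((size pre).+1, M).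
    by rewrite /step nth_code MR aK.
  case: eqP step1 => [Ra|Ra] step1.
    by exists 1, M, R, H; split; rewrite /= ?step1 //; exact: H0.
  have [t [M' [R' [H' [bt et MR' HQ]]]]] :=
    IH (rcons pre (IJz a (size pre + (csize b).+1))) post _ _ _ _ wb MR (H1 Ra).
  exists t.+1, M', R', H'; split=> //.
  rewrite iterSr step1; move: et.
  by rewrite size_rcons -cats1 -!catA /= addSn addnS.
- move=> a b IH pre post Q R H M /andP[aK wb] MR [k kN].
  set P := (X in step X).
  have step1 M1 R1 H1 : represents M1 R1 H1 -> step P (size pre, M1) =
      if nth 0 R1 a == 0 then (size pre + (csize b).+2, M1) else ((size pre).+1, M1).
    by move=> MR1; rewrite /step nth_code MR1 aK.
  have step2 M1 R1 H1 : represents M1 R1 H1 -> nth 0 R1 zreg = 0 ->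
      step P ((size pre).+1 + csize b, M1) = (size pre, M1).
    move=> MR1 Rz; have P1: nth IHalt P ((size pre).+1 + csize b) = IJz zreg (size pre).
      have := nth_code (rcons pre (IJz a (size pre + (csize b).+2)) ++
        compile (size pre).+1 b) (IJz zreg (size pre)) post.
      by rewrite size_cat size_rcons size_compile /P -!cats1 -!catA.
    by rewrite /step P1 MR1 Rz.
  (* The bound mentions the actual iteration count [k] instead of [N], so that it shrinks along the
     induction on [k]. *)
  move=> Hk; suff [t [M' [R' [H' [bt *]]]]]: exists t M' R' H',
      [/\ t <= (k * (cost N b).+2).+1,
       iter t (step P) (size pre, M) = (size pre + (csize b).+2, M'),
       represents M' R' H' & Q R' H'].
    exists t, M', R', H'; split=> //; apply: leq_trans bt _.
    by rewrite ltnS leq_mul2r kN orbT.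
  elim: k R H M MR {kN} Hk => [|k IHk] R H M MR [Ra Hk].
    by move: (step1 _ _ _ MR); rewrite Ra eqxx => e1; exists 1, M, R, H; split.
  have [t [M' [R' [H' [bt et MR' [Rz Hl]]]]]] :=
    IH (rcons pre (IJz a (size pre + (csize b).+2))) (IJz zreg (size pre) :: post) _ _ _ _ wb MR Hk.
  have [t' [M2 [R2 [H2 [bt' et' MR2 HQ]]]]] := IHk _ _ _ MR' Hl.
  exists (t' + (t.+2)), M2, R2, H2; split=> //.
    by move: bt bt'; rewrite mulSn; move: (k * _); lia.
  rewrite iterD -[RHS]et'; congr iter.
  rewrite iterS iterSr (step1 _ _ _ MR); case: eqP => // _.
  rewrite -(step2 _ _ _ MR' Rz); congr step; move: et.
  by rewrite size_rcons /P -!cats1 -!catA => ->; rewrite addSn.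
Qed.

Arguments wp : simpl never.

(** * Synchronous executions and their schedules *)

Section Rank.
Variables (E : seq event) (po : rel event).
Hypothesis hE : abstract_execution E po.
Local Notation rk := (po_rank E po).

(** By transitivity, [e] and its predecessors all lie among the predecessors of [f], and [e] is not
    its own predecessor. *)
Lemma po_rank_lt e f : po e f -> rk e < rk f.
Proof.
case: hE => uE _ poE [irr tr] _ ef; have [eE _ _] := poE _ _ ef.
rewrite /po_rank -!size_filter -[_.+1]/(size (e :: _)).
apply: uniq_leq_size; first by rewrite /= filter_uniq // mem_filter irr.
move=> x; rewrite inE !mem_filter => /orP[/eqP->|/andP[xe xE]]; first by rewrite ef.
by rewrite (tr _ _ _ xe ef).
Qed.

Lemma po_rankE e f : e \in E -> f \in E -> thr e = thr f -> po e f = (rk e < rk f).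
Proof.
case: (hE) => _ _ _ [irr _] tot eE fE th; apply/idP/idP; first exact: po_rank_lt.
move=> lt; have nef : e <> f by move=> ef; rewrite ef ltnn in lt.
by case: (tot _ _ eE fE th nef) => // /po_rank_lt; rewrite ltnNge ltnW.
Qed.

Lemma po_rank_inj e f : e \in E -> f \in E -> thr e = thr f -> rk e = rk f -> e = f.
Proof.
case: (hE) => _ _ _ _ tot eE fE th rr; apply/eqP/contraT => /eqP nef.
by case: (tot _ _ eE fE th nef) => /po_rank_lt; rewrite rr ltnn.
Qed.

(** Take a predecessor of [f] of maximal rank: all other predecessors of [f] lie below it. *)
Lemma po_rank_pred f : f \in E -> 0 < rk f ->
  exists2 e, e \in E & thr e = thr f /\ rk f = (rk e).+1.
Proof.
case: (hE) => uE _ poE [irr tr] tot fE rf0.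
have [e ef emax] : exists2 e, po e f & forall x, po x f -> rk x <= rk e.
  have : has (po^~ f) E by rewrite has_count.
  move=> /hasP[e0 e0E e0f].
  pose P m := has (fun x => po x f && (rk x == m)) E.
  have exP : exists m, P m by exists (rk e0); apply/hasP; exists e0; rewrite ?e0f ?eqxx.
  have ubP m : P m -> m <= rk f.
    by move=> /hasP[x _ /andP[xf /eqP<-]]; exact/ltnW/po_rank_lt.
  case: (ex_maxnP exP ubP) => m /hasP[e eE /andP[ef /eqP em]] mmax.
  exists e => // x xf; rewrite em; apply: mmax; apply/hasP; exists x; rewrite ?xf ?eqxx //.
  by have [] := poE _ _ xf.
have [eE _ th] := poE _ _ ef; exists e => //; split=> //.
apply/eqP; rewrite eqn_leq po_rank_lt // andbT.
rewrite /po_rank -!size_filter -[_.+1]/(size (e :: _)).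
apply: uniq_leq_size; first exact: filter_uniq.
move=> x; rewrite inE !mem_filter => /andP[xf xE]; rewrite xE andbT.
apply/orP; case: (eqVneq x e) => [|/eqP ne]; [by left|right].
have [_ _ thx] := poE _ _ xf.
case: (tot x e xE eE) => //; first by rewrite thx th.
by move=> /po_rank_lt; rewrite ltnNge emax.
Qed.
End Rank.

(** * Executions as sequences of send-receive blocks *)

Definition flat (prs : seq (event * event)) : seq event :=
  flatten [seq [:: p.1; p.2] | p <- prs].

Lemma flat_cons p prs : flat (p :: prs) = [:: p.1, p.2 & flat prs].
Proof. by []. Qed.

Lemma flat_rcons p prs : flat (rcons prs p) = flat prs ++ [:: p.1; p.2].
Proof. by rewrite /flat map_rcons flatten_rcons. Qed.

Lemma size_flat prs : size (flat prs) = (size prs).*2.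
Proof. by elim: prs => //= p prs IH; rewrite IH. Qed.

Lemma mem_flat prs e : (e \in flat prs) = has (fun p => (e == p.1) || (e == p.2)) prs.
Proof. by elim: prs => //= p prs IH; rewrite flat_cons !inE IH orbA. Qed.

Lemma perm_flat prs prs' : perm_eq prs prs' -> perm_eq (flat prs) (flat prs').
Proof. by move=> ?; apply: perm_flatten; exact: perm_map. Qed.

(** [rendezvous] is what [rf_instance] guarantees for each pair; [admissible] gathers the conditions
    left for the program to test. *)
Definition rendezvous (p : event * event) :=
  [&& is_snd p.1, ~~ is_snd p.2 & chan p.1 == chan p.2].
Definition admissible (p : event * event) :=
  (thr p.1 != thr p.2) && (value p.1 == value p.2).

Lemma sends_flat ch prs : all rendezvous prs ->
  sends ch (flat prs) = [seq p.1 | p <- prs & chan p.1 == ch].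
Proof.
elim: prs => //= p prs IH /andP[/and3P[s1 s2 c] /IH {}IH].
by rewrite /= s1 (negbTE s2) /= -/(sends ch (flat prs)) IH; case: ifP.
Qed.

Lemma rcvs_flat ch prs : all rendezvous prs ->
  rcvs ch (flat prs) = [seq p.2 | p <- prs & chan p.1 == ch].
Proof.
elim: prs => //= p prs IH /andP[/and3P[s1 s2 /eqP c] /IH {}IH].
by rewrite /= s1 s2 /= -/(rcvs ch (flat prs)) IH c; case: ifP.
Qed.

(** Each block contributes one send and one receive to its channel, so equal indices pick out the
    same block. *)
Lemma rf_of_flat prs s r : all rendezvous prs ->
  rf_of (flat prs) s r <-> (s, r) \in prs.
Proof.
move=> rv; split.
  move=> [ch [i [_]]]; rewrite sends_flat // rcvs_flat // size_map => isz.
  rewrite !(nth_map (e0, e0)) // => -> ->; rewrite -surjective_pairing.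
  by have := mem_nth (e0, e0) isz; rewrite mem_filter => /andP[].
move=> srin; pose ps := [seq p <- prs | chan p.1 == chan s].
have sr : (s, r) \in ps by rewrite mem_filter eqxx.
exists (chan s), (index (s, r) ps).
rewrite sends_flat // rcvs_flat // !size_map !(nth_map (e0, e0)) ?index_mem //.
by rewrite nth_index.
Qed.

(** Two events are removed at a time: the first event has no predecessor, so it is a send, and the
    second is its receive. *)
Lemma sync_flat s :
    (forall i, i < size s ->
     let e := nth e0 s i in
     (is_snd e -> i.+1 < size s /\ let f := nth e0 s i.+1 in
        [/\ ~~ is_snd f, chan f = chan e & thr f <> thr e]) /\
     (~~ is_snd e -> 0 < i /\ is_snd (nth e0 s i.-1))) ->
  exists prs, [/\ s = flat prs, all rendezvous prs & all (fun p => thr p.1 != thr p.2) prs].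
Proof.
elim: {s}_.+1 {-2}s (ltnSn (size s)) => // n IH [|e [|f s]] sz ok.
- by exists [::].
- have [o1 o2] := ok 0 isT.
  by case E: (is_snd e); [have [] := o1 E|have [] := o2 (negbT E)].
have [o1 o2] := ok 0 isT.
case E: (is_snd e); last by have [] := o2 (negbT E).
have /= [_ [sf cf tf]] := o1 E.
have [||prs [-> rv th]] := IH s.
- by move: sz => /=; lia.
- move=> i isz; have [] := ok i.+2 isz => /= oi1 oi2; split=> // /oi2 [_].
  (* For [i = 0] the predecessor is the receive [f], so the tail cannot begin with a receive
     either. *)
  by case: i {oi1 oi2} isz => //=; rewrite (negbTE sf).
exists ((e, f) :: prs); split=> //=; rewrite ?rv ?th /rendezvous /= ?E ?sf ?cf ?eqxx //=.
by rewrite andbT; apply/eqP => te; apply: tf.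
Qed.

Lemma nth_flat prs i : i < size (flat prs) ->
  nth e0 (flat prs) i =
    (if odd i then snd else fst) (nth (e0, e0) prs i./2).
Proof.
elim: prs i => [|p prs IH] [|[|i]] //=; rewrite !ltnS => /IH ->.
by rewrite negbK.
Qed.

(** Sends sit at even positions and receives at odd ones. The adjacency clause then amounts to
    distinct threads, the value clause to equal values inside each block, and the capacity clause is
    vacuous. *)
Lemma well_formed_flat prs : all rendezvous prs ->
  well_formed cap_sync (flat prs) <-> uniq (flat prs) /\ all admissible prs.
Proof.
move=> rv; split.
  move=> [us [_ [sync vals]]]; split=> //; apply/allP => p pin.
  have /and3P[sp rp cp] := allP rv _ pin.
  pose j := index p prs; have jp : j < size prs by rewrite index_mem.
  have js : j.*2 < size (flat prs) by rewrite size_flat ltn_double.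
  have js1 : j.*2.+1 < size (flat prs) by rewrite size_flat; lia.
  have n0 : nth e0 (flat prs) j.*2 = p.1.
    by rewrite nth_flat // odd_double doubleK nth_index.
  have n1 : nth e0 (flat prs) j.*2.+1 = p.2.
    by rewrite nth_flat //= odd_double uphalf_double nth_index.
  have [+ _] := sync (chan p.1) erefl j.*2 js; rewrite /= n0 n1.
  case=> // _ [_ [_ th]]; apply/andP; split.
    by apply/eqP => te; apply: th.
  pose ps := [seq q <- prs | chan q.1 == chan p.1].
  have pps : p \in ps by rewrite mem_filter eqxx.
  have := vals (chan p.1) (index p ps).
  rewrite sends_flat // rcvs_flat // !size_map !(nth_map (e0, e0)) ?index_mem //.
  by rewrite nth_index // => /(_ pps) [_ ->].
move=> [us ad]; split=> //; split; first by [].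
split=> [ch _ i isz|ch i].
  have hi : i./2 < size prs by move: isz; rewrite size_flat; lia.
  have pin := mem_nth (e0, e0) hi.
  have /and3P[sp rp /eqP cp] := allP rv _ pin.
  have /andP[/eqP tp _] := allP ad _ pin.
  rewrite /= nth_flat //; case: (boolP (odd i)) => oi /=.
    split; first by move=> []; rewrite (negbTE rp).
    have i0 : 0 < i by case: i oi {isz hi pin sp rp cp tp}.
    rewrite nth_flat; last by lia.
    have -> : i.-1./2 = i./2 by lia.
    have -> : odd i.-1 = false by lia.
    by move=> [_ <-]; rewrite cp.
  have i1 : i.+1 < size (flat prs) by move: isz; rewrite size_flat; lia.
  split; last by rewrite sp => -[].
  move=> [_ <-]; rewrite nth_flat //.
  have -> : i.+1./2 = i./2 by lia.
  by rewrite /= oi; split=> //; split=> //; split=> // te; apply: tp.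
rewrite sends_flat // rcvs_flat // !size_map => isz; split=> //.
rewrite !(nth_map (e0, e0)) //.
have := mem_nth (e0, e0) isz; rewrite mem_filter => /andP[_ pin].
by have /andP[_ /eqP] := allP ad _ pin.
Qed.

(** The blocks of an execution form its reads-from relation; as neither list repeats a pair, they
    are permutations of each other. Since [po] is total on each thread, respecting it already forces
    equality with [po_of]. *)
Lemma consistent_flat E po rf : abstract_execution E po -> rf_instance E rf ->
  consistent_rf cap_sync E po rf <->
  exists prs, [/\ perm_eq prs rf, perm_eq (flat prs) E, all admissible prs &
    forall e f, po e f -> index e (flat prs) < index f (flat prs)].
Proof.
move=> hE [urf rfE]; have [uE _ poE [irr tr] tot] := hE.
have rvrf : all rendezvous rf.
  by apply/allP => p /rfE[_ _ s r c]; rewrite /rendezvous s r c eqxx.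
split.
  move=> [s [[sE pos wf] rfs]]; have [us [_ [sync _]]] := wf.
  have [|prs [sfl rv th]] := @sync_flat s.
    move=> i isz; have [o1 o2] := sync (chan (nth e0 s i)) erefl i isz; split.
      by move=> se; have [//|i1 [? [? ?]]] := o1; split.
    by move=> se; have [//|i1 [? [? ?]]] := o2; split.
  move: wf; rewrite {}sfl in sE pos us rfs {sync} *.
  move=> /(well_formed_flat rv)[_ ad].
  exists prs; split=> //; last first.
    by move=> e f; rewrite -pos => /and4P[].
  have uprs : uniq prs.
    elim: (prs) us => //= p ps IH /and3P[p1 p2 /IH ->]; rewrite andbT.
    apply: contra p1 => pps; rewrite inE; apply/orP; right.
    by rewrite mem_flat; apply/hasP; exists p; rewrite ?eqxx.
  apply: uniq_perm => // -[e f]; apply/idP/idP.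
    by move=> prsi; apply/rfs; apply/(rf_of_flat _ _ rv).
  by move=> /rfs /(rf_of_flat _ _ rv).
move=> [prs [prf pE ad lt]].
have rv : all rendezvous prs by rewrite (perm_all _ prf).
exists (flat prs); split; last first.
  by move=> e f; rewrite -(perm_mem prf); split=> /(rf_of_flat _ _ rv).
split=> //; last by apply/well_formed_flat; rewrite // (perm_uniq pE).
move=> e f; apply/and4P/idP => [[]|ef].
  rewrite !(perm_mem pE) => eE fE /eqP th ltef.
  have [|//|/lt] := tot e f eE fE th; first by move=> e_f; rewrite e_f ltnn in ltef.
  by rewrite ltnNge ltnW.
have [eE fE th] := poE _ _ ef.
by rewrite !(perm_mem pE); split=> //; [exact/eqP|exact: lt].
Qed.

(* The partner table after processing the pairs of [prs] from left to right,
   later writes overriding earlier ones. *)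
Definition mate (prs : seq (event * event)) : event -> option event :=
  foldl (fun m p e => if e == p.2 then Some p.1 else if e == p.1 then Some p.2 else m e)
    (fun => None) prs.

Lemma mate_rcons prs p e : mate (rcons prs p) e =
  if e == p.2 then Some p.1 else if e == p.1 then Some p.2 else mate prs e.
Proof. by rewrite /mate -cats1 foldl_cat. Qed.

Lemma mate_mem prs e : (mate prs e != None) = (e \in flat prs).
Proof.
elim/last_ind: prs => [|prs p IH] //.
rewrite mate_rcons flat_rcons mem_cat !inE -IH.
by case: (e == p.2); case: (e == p.1); rewrite ?orbT ?orbF.
Qed.

Lemma mate_pair prs p : uniq (flat prs) -> p \in prs ->
  mate prs p.1 = Some p.2 /\ mate prs p.2 = Some p.1.
Proof.
elim/last_ind: prs => [|prs q IH] //.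
rewrite flat_rcons cat_uniq => /and3P[u /hasPn disj /= /andP[q12 _]].
rewrite mem_rcons inE !mate_rcons => /predU1P[->|pin].
  by rewrite !eqxx; move: q12; rewrite inE; case: eqP.
have [<- <-] := IH u pin.
have aux e : e \in flat prs -> (e == q.1 = false) /\ (e == q.2 = false).
  by move=> ein; split; apply/negbTE; apply: contraL ein => /eqP->; apply: disj;
    rewrite !inE eqxx ?orbT.
have [|-> ->] := aux p.1; first by rewrite mem_flat; apply/hasP; exists p; rewrite ?eqxx.
have [|-> ->] := aux p.2; first by rewrite mem_flat; apply/hasP; exists p; rewrite ?eqxx ?orbT.
by [].
Qed.

Definition good prs := uniq (flat prs) && all admissible prs.

(** This allows an incremental test: an event has been used before exactly when its partner entry is
    set. *)
Lemma good_rcons prs p : p.1 != p.2 -> good (rcons prs p) =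
  [&& good prs, admissible p, mate prs p.1 == None & mate prs p.2 == None].
Proof.
move=> p12; rewrite /good flat_rcons cat_uniq all_rcons /= inE p12 orbF !andbT.
rewrite -!mate_mem negb_or !negbK.
by do !case: (_ == None); case: (uniq _); case: (all _ _); case: admissible.
Qed.

Lemma index_flat prs p : uniq (flat prs) -> p \in prs ->
  index p.1 (flat prs) = (index p prs).*2 /\ index p.2 (flat prs) = (index p prs).*2.+1.
Proof.
move=> u pin; have isz : index p prs < size prs by rewrite index_mem.
have s1 : (index p prs).*2.+1 < size (flat prs) by rewrite size_flat; lia.
have n1 := nth_flat s1; have n0 := nth_flat (ltnW s1).
move: n0 n1; rewrite /= odd_double doubleK uphalf_double nth_index //= => <- <-.
by rewrite !index_uniq // ltnW.
Qed.

(** * The queue and its equivalence with the existence of an ordering of the pairs *)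

Section Schedule.
Variables (E ord : seq event) (po : rel event) (rf : seq (event * event)).
Hypotheses (hE : abstract_execution E po) (hord : perm_eq ord E).
Hypotheses (hgood : good rf) (hrf : perm_eq (flat rf) E).
Local Notation rk := (po_rank E po).

Definition mt e := odflt e (mate rf e).

(** A list of length at most one, so that the last event of a thread needs no separate case. *)
Definition succs e := [seq x <- E | (thr x == thr e) && (rk x == (rk e).+1)].

(** The list never shrinks: it records all events ever enqueued, and the first [k] of them have been
    dequeued. Once the queue has run empty, the remaining steps idle. *)
Definition enqueue (q : seq event) (k : nat) : seq event :=
  if k < size q then
    let e := nth e0 q k in
    if mt e \in take k.+1 q then q ++ succs e ++ succs (mt e) else q
  else q.

Fixpoint queue (k : nat) : seq event :=
  if k is k'.+1 then enqueue (queue k') k' else [seq e <- ord | rk e == 0].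

Let uE : uniq E. Proof. by case: hE. Qed.
Let urf : uniq (flat rf). Proof. by case/andP: hgood. Qed.

Lemma mt_pair p : p \in rf -> mt p.1 = p.2 /\ mt p.2 = p.1.
Proof. by move=> /(mate_pair urf)[m1 m2]; rewrite /mt m1 m2. Qed.

Lemma mtP e : e \in E -> [/\ mt e \in E, mt (mt e) = e & thr (mt e) != thr e].
Proof.
rewrite -(perm_mem hrf) mem_flat => /hasP[p pin pe].
have [m1 m2] := mt_pair pin.
have p1 : p.1 \in E by rewrite -(perm_mem hrf) mem_flat; apply/hasP; exists p; rewrite ?eqxx.
have p2 : p.2 \in E by rewrite -(perm_mem hrf) mem_flat; apply/hasP; exists p; rewrite ?eqxx ?orbT.
have /andP[_ /allP /(_ p pin) /andP[th _]] := hgood.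
by case/orP: pe => /eqP ->; rewrite ?m1 ?m2 ?m1 ?m2; split; rewrite // eq_sym.
Qed.

Lemma mem_succs x e :
  (x \in succs e) = [&& x \in E, thr x == thr e & rk x == (rk e).+1].
Proof. by rewrite mem_filter andbC. Qed.

Lemma size_succs e : size (succs e) <= 1.
Proof.
case Es: (succs e) => [|x [|y s]] //.
have u : uniq (succs e) by rewrite filter_uniq.
have := mem_succs x e; have := mem_succs y e; rewrite Es !inE !eqxx !orbT.
move=> /esym/and3P[yE /eqP ty /eqP ry] /esym/and3P[xE /eqP tx /eqP rx].
move: u; rewrite Es /= inE (po_rank_inj hE xE yE) ?eqxx //; first by rewrite tx.
by rewrite rx.
Qed.

Definition fired (s : seq event) e := (e \in s) && (mt e \in s).

(** The queue consists exactly of the thread heads and the successors of fired events. In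
    [queue_src], the bound by [j] says that the pair of the predecessor fired before the event was
    enqueued, and the bound by [k] that both of its events have been dequeued. *)
Record queue_inv (q : seq event) (k : nat) : Prop := QueueInv {
  queue_uniq : uniq q;
  queue_sub : {subset q <= E};
  queue_src : forall j, j < size q -> rk (nth e0 q j) = 0 \/
    exists y, [/\ y \in E, thr y = thr (nth e0 q j), rk (nth e0 q j) = (rk y).+1 &
      fired (take (minn j k) q) y];
  queue_tgt : forall x, x \in E -> rk x = 0 -> x \in q;
  queue_succ : forall x y, x \in E -> y \in E -> thr y = thr x ->
    rk x = (rk y).+1 -> fired (take k q) y -> x \in q }.


Lemma fired_mt s e : e \in E -> fired s (mt e) = fired s e.
Proof. by case/mtP=> _ mm _; rewrite /fired mm andbC. Qed.

Lemma fired_sub s s' e : {subset s <= s'} -> fired s e -> fired s' e.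
Proof. by move=> ss /andP[/ss a /ss b]; rewrite /fired a. Qed.

Lemma sub_take (T : eqType) (s : seq T) i j : i <= j -> {subset take i s <= take j s}.
Proof. by move=> ij x; rewrite -{1}(take_takel s ij) => /mem_take. Qed.

Lemma succs_sub e : {subset succs e <= E}.
Proof. by move=> x; rewrite mem_succs => /and3P[]. Qed.

Lemma enqueue_inv q k : queue_inv q k -> queue_inv (enqueue q k) k.+1.
Proof.
move=> [uq qE src tgt suc]; rewrite /enqueue; case: ltnP => [kq|qk]; last first.
  split=> //.
    move=> j jq; have [|[y [yE ty ry fy]]] := src j jq; [by left|right].
    by exists y; split=> //; apply: fired_sub fy; apply: sub_take; lia.
  move=> x y xE yE ty ry fy; apply: (suc x y) => //.
  by move: fy; rewrite !take_oversize // ltnW.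
set e := nth e0 q k; have eq : e \in q by rewrite mem_nth.
have eE := qE _ eq; have [mE mm mth] := mtP eE.
have tk1 : take k.+1 q = rcons (take k q) e by rewrite (take_nth e0).
have enk : e \notin take k q.
  by apply/negP => /(nthP e0)[i]; rewrite size_takel ?(ltnW kq) // => ik;
    rewrite nth_take // => /eqP; rewrite nth_uniq ?(ltn_trans ik) //; lia.
case: ifP => [mtk|mtk]; last first.
  split=> //.
    move=> j jq; have [|[y [yE ty ry fy]]] := src j jq; [by left|right].
    by exists y; split=> //; apply: fired_sub fy; apply: sub_take; lia.
  move=> x y xE yE ty ry fy; apply: (suc x y) => //.
  move: fy; rewrite /fired tk1 !mem_rcons !inE => /andP[y1 y2].
  have {}mtk : mt e \notin rcons (take k q) e by rewrite -tk1 mtk.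
  (* Nothing fires in this case: a pair completed by [e] would have [mt e] among the dequeued
     events. *)
  have ye : y != e.
    by apply: contraNneq mtk => ye; move: y2; rewrite ye mem_rcons inE.
  have mye : mt y != e.
    apply: contraNneq mtk => mye; have [_ mmy _] := mtP yE.
    by rewrite -mye mmy mye mem_rcons inE.
  by move: y1 y2; rewrite (negbTE ye) (negbTE mye) /= => -> ->.
(* The pair [e, mt e] becomes complete now, so its successors are new. *)
have fe : fired (take k.+1 q) e by rewrite /fired mtk tk1 mem_rcons inE eqxx.
have nfe : ~~ fired (take k q) e by rewrite /fired (negbTE enk).
have fresh d : d = e \/ d = mt e -> forall x, x \in succs d -> x \notin q.
  move=> de x; have dE : d \in E by case: de => ->.
  have nfd : ~~ fired (take k q) d by case: de => ->; rewrite ?fired_mt.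
  rewrite mem_succs // => /and3P[xE /eqP tx /eqP rx]; apply: contra nfd => xq.
  have jx : index x q < size q by rewrite index_mem.
  (* An event of positive rank enters the queue only after its thread predecessor has fired; the
     predecessor of [x] is [d], which has not. *)
  have [|[y [yE]]] := src _ jx; rewrite nth_index // rx // => ty [ry].
  rewrite (po_rank_inj hE dE yE) ?ty //; apply: fired_sub.
  by apply: sub_take; rewrite geq_minr.
have usuc d : uniq (succs d) by rewrite filter_uniq.
have disj x : x \in succs e -> x \notin succs (mt e).
  rewrite !mem_succs // => /and3P[_ /eqP tx _]; rewrite tx eq_sym (negbTE mth) /=.
  by rewrite andbF.
have stk j : j <= size q -> take j (q ++ succs e ++ succs (mt e)) = take j q.
  by move=> jq; rewrite takel_cat.
split.
- rewrite !cat_uniq uq !usuc /= andbT; apply/andP; split.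
    apply/hasPn => x; rewrite mem_cat => /orP[] xs.
      exact: fresh (or_introl erefl) _ xs.
    exact: fresh (or_intror erefl) _ xs.
  by apply/hasPn => x xs; apply: contraL xs; exact: disj.
- by move=> x; rewrite !mem_cat => /or3P[/qE|/succs_sub|/succs_sub].
- move=> j; rewrite size_cat => jsz; rewrite nth_cat.
  case: ltnP => jq.
    have [|[y [yE ty ry fy]]] := src j jq; [by left|right].
    exists y; split=> //; rewrite stk; last exact: leq_trans (geq_minl _ _) (ltnW jq).
    by apply: fired_sub fy; apply: sub_take; rewrite leq_min geq_minl leqW ?geq_minr.
  right; set x := nth _ _ _.
  have : x \in succs e ++ succs (mt e) by apply: mem_nth; rewrite ltn_subLR.
  have -> : minn j k.+1 = k.+1 by apply/minn_idPr; exact: leq_trans jq.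
  rewrite stk // mem_cat => /orP[]; rewrite mem_succs // => /and3P[xE /eqP tx /eqP rx].
    by exists e.
  by exists (mt e); rewrite fired_mt.
- by move=> x xE r0; rewrite mem_cat tgt.
move=> x y xE yE ty ry; rewrite stk // => fy; rewrite mem_cat.
case fky: (fired (take k q) y); first by rewrite (suc x y).
suff: y = e \/ y = mt e.
  move=> ye; have xsy : x \in succs y by rewrite mem_succs // xE ty ry !eqxx.
  by rewrite mem_cat; case: ye => <-; rewrite xsy !orbT.
have [_ mmy _] := mtP yE.
move: fy fky; rewrite /fired tk1 !mem_rcons !inE.
case: eqP => [->|_]; first by left.
case: eqP => [<-|_] /=; first by right.
by move=> ->.
Qed.

Lemma queue_invP k : queue_inv (queue k) k.
Proof.
elim: k => [|k IH] /=; last exact: enqueue_inv.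
have uo : uniq ord by rewrite (perm_uniq hord).
split.
- exact: filter_uniq.
- by move=> x; rewrite mem_filter (perm_mem hord) => /andP[].
- by move=> j /(mem_nth e0); rewrite mem_filter => /andP[/eqP -> _]; left.
- by move=> x xE r0; rewrite mem_filter r0 (perm_mem hord) eqxx.
by move=> x y; rewrite take0.
Qed.

Lemma size_queue k : size (queue k) <= size E.
Proof. by case: (queue_invP k) => uq qE _ _ _; exact: uniq_leq_size. Qed.


Definition fire_time (q : seq event) e := maxn (index e q) (index (mt e) q).

Lemma mt_mem e : e \in E -> exists2 p, p \in rf & e = p.1 /\ mt e = p.2 \/ e = p.2 /\ mt e = p.1.
Proof.
rewrite -(perm_mem hrf) mem_flat => /hasP[p pin pe].
have [m1 m2] := mt_pair pin.
by exists p => //; case/orP: pe => /eqP->; [left|right].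
Qed.

(** Induction on the rank of [f]. Its immediate predecessor [y] fired before [f] was enqueued; if
    [e] is not [y], then [e] fired before [y] was enqueued, hence before [y] fired. *)
Lemma fire_time_lt k e f : {subset E <= queue k} -> po e f ->
  fire_time (queue k) e < index f (queue k).
Proof.
set q := queue k => Eq ef; have [uq qE src tgt suc] := queue_invP k.
have poE : forall e f, po e f -> [/\ e \in E, f \in E & thr e = thr f].
  by case: hE.
elim: {f}(rk f) {-2}f (erefl (rk f)) ef => [|m IH] f rf' ef.
  by have := po_rank_lt hE ef; rewrite rf'.
have [eE fE th] := poE _ _ ef; have fq := Eq _ fE.
have fsz : index f q < size q by rewrite index_mem.
have [|] := src _ fsz; rewrite nth_index // rf' //.
move=> [y [yE ty [ry] /andP[y1 y2]]].
have sub x : x \in take (minn (index f q) k) q -> index x q < index f q.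
  move=> xin; have xq := mem_take xin.
  by move: xin; rewrite in_take // => /leq_trans; apply; exact: geq_minl.
have ltyf : fire_time q y < index f q by rewrite gtn_max !sub.
have [eqy|ney] := eqVneq e y; first by rewrite eqy.
have ey : po e y.
  rewrite (po_rankE hE) //; last by rewrite th ty.
  have := po_rank_lt hE ef; rewrite rf' ry ltnS leq_eqVlt => /predU1P[re|//].
  by case/eqP: ney; apply: (po_rank_inj hE) => //; rewrite th ty.
apply: leq_ltn_trans ltyf; apply/ltnW; apply: leq_trans (IH _ _ ey) _ => //.
exact: leq_maxl.
Qed.

Lemma schedule : size (queue (size E)) = size E <->
  exists prs, [/\ perm_eq prs rf, perm_eq (flat prs) E, all admissible prs &
    forall e f, po e f -> index e (flat prs) < index f (flat prs)].
Proof.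
have poE : forall e f, po e f -> [/\ e \in E, f \in E & thr e = thr f].
  by case: hE.
set q := queue (size E); have [uq qE src tgt suc] := queue_invP (size E).
split=> [sq|[prs [prf pE ad lt]]]; last first.
  apply/eqP; rewrite eqn_leq size_queue; apply: uniq_leq_size => // x xE.
  have upr : uniq (flat prs) by rewrite (perm_uniq pE).
  elim: {x}_.+1 {-2}x (ltnSn (index x (flat prs))) xE => // m IH x xm xE.
  have [r0|rpos] := posnP (rk x); first exact: tgt.
  have [y yE [ty ry]] := po_rank_pred hE xE rpos.
  have yx : po y x by rewrite (po_rankE hE) // ry.
  have ltyx := lt _ _ yx.
  (* The partner of [y] is adjacent to [y] and differs from [x], being in another thread; hence it
     precedes [x] too. *)
  have ltmx : index (mt y) (flat prs) < index x (flat prs).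
    have [p] := mt_mem yE; rewrite -(perm_mem prf) => pin pe.
    have [_ _ mth] := mtP yE.
    have xm' : index x (flat prs) != index (mt y) (flat prs).
      apply: contra mth => /eqP e1; rewrite ty.
      have := nth_index e0 (s := flat prs) (x := x); rewrite e1 nth_index.
        by rewrite (perm_mem pE) => /(_ xE) ->.
      by rewrite (perm_mem pE); case: (mtP yE).
    have [i1 i2] := index_flat upr pin; move: ltyx xm'.
    by case: pe => -[-> ->]; rewrite i1 i2; move: (index x _) (index p _); clear; lia.
  (* The queue never exceeds [size E] events, so after [size E] steps all enqueued events have been
     dequeued. *)
  apply: (suc x y) => //; rewrite take_oversize ?size_queue //.
  have [mE _ _] := mtP yE.
  by rewrite /fired !IH //; move: xm ltyx ltmx; clear; lia.
have Eq : {subset E <= q} by move=> x; have [_ ->] := uniq_min_size uq qE (eq_leq (esym sq)).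
pose tm p := maxn (index p.1 q) (index p.2 q).
pose le := relpre tm leq.
pose prs := sort le rf.
have prf : perm_eq prs rf by rewrite perm_sort.
have pE : perm_eq (flat prs) E by apply: perm_trans hrf; exact: perm_flat.
exists prs; split=> //.
  by rewrite (perm_all _ prf); case/andP: hgood.
move=> e f ef; have [eE fE _] := poE _ _ ef.
have [p pin pe] := mt_mem eE; have [p' pin' pf] := mt_mem fE.
have tmp : tm p = fire_time q e.
  by case: pe => -[ee m]; rewrite /tm /fire_time m ee // maxnC.
have tmp' : tm p' = fire_time q f.
  by case: pf => -[ee m]; rewrite /tm /fire_time m ee // maxnC.
have lttm : tm p < tm p'.
  by rewrite tmp tmp'; apply: leq_trans (fire_time_lt Eq ef) _; exact: leq_maxl.
rewrite -(perm_mem prf) in pin; rewrite -(perm_mem prf) in pin'.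
have ltpp' : index p prs < index p' prs.
  rewrite ltnNge; apply: contraL lttm => lei; rewrite -leqNgt.
  have srt : sorted le prs by apply: sort_sorted => x y; exact: leq_total.
  apply: (sorted_leq_index _ _ srt) => //.
    by move=> x y z; exact: leq_trans.
  by move=> x; exact: leqnn.
have upr : uniq (flat prs) by rewrite (perm_uniq pE); case: hE.
have [i1 i2] := index_flat upr pin; have [i1' i2'] := index_flat upr pin'.
case: pe => -[-> _]; case: pf => -[-> _]; rewrite ?i1 ?i2 ?i1' ?i2';
  by move: ltpp'; clear; lia.
Qed.

End Schedule.

(** By counting: as many distinct events of [E] as [E] has elements. *)
Lemma good_perm E po rf : abstract_execution E po -> rf_instance E rf ->
  (size rf).*2 = size E -> good rf -> perm_eq (flat rf) E.
Proof.
move=> hE hrf sz /andP[u _].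
have sub : {subset flat rf <= E}.
  move=> x; rewrite mem_flat => /hasP[p /(proj2 hrf)[p1 p2 _ _ _]].
  by case/orP => /eqP->.
have [|_ eqi] := uniq_min_size u sub; first by rewrite size_flat sz.
by apply: uniq_perm => //; case: hE.
Qed.

(** The three conditions are the successive tests of the program: [check_size], [match_pairs] and
    [sched]. *)
Lemma consistent_queue E ord po rf :
    abstract_execution E po -> rf_instance E rf -> perm_eq ord E ->
  consistent_rf cap_sync E po rf <->
  [/\ (size rf).*2 = size E, good rf & size (queue E ord po rf (size E)) = size E].
Proof.
move=> hE hrf hord; rewrite (consistent_flat hE hrf); split.
  move=> [prs [prf pE ad lt]].
  have rE : perm_eq (flat rf) E.
    by apply: perm_trans pE; apply: perm_flat; rewrite perm_sym.
  have gd : good rf.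
    by rewrite /good (perm_uniq rE) -(perm_all _ prf) ad andbT; case: hE.
  split=> //; first by rewrite -size_flat (perm_size rE).
  by apply/(schedule hE hord gd rE); exists prs.
move=> [sz gd sq]; apply/(schedule hE hord gd) => //; exact: good_perm hE hrf sz gd.
Qed.

(** * The program *)

(* Registers: 0 counts the defects found so far (in [save_input] it is first a
   pointer), 1 holds [r], the size of [rf], 2 the constant 1, 3 the address
   [A = 64 n], 4 a loop counter, 5 and 6 pointers, 7, 8 and 9 hold [2 A], [5 A]
   and the tail of the queue, 10 to 13 are scratch, 14, 16 and 17 hold the
   constants 0, 4 and 3, and 15 holds [n].

   The input occupies the low addresses where the registers live.  It is moved
   to [A], and the tables follow in blocks of length [A]: with an event denoted
   by its address [e] in the copied input, its partner is at [e + A], a mark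
   telling whether it has been dequeued at [e + 2 A], [7 A + t A] (the row of
   thread [t]) at [5 A + t], the queue starts at [6 A], and the event of rank
   [k] in thread [t] is at [7 A + t A + k]. *)
Definition push (x : nat) : cmd :=
  Read x 12 ;; Add 12 8 12 ;; Read 12 12 ;; Add x 16 13 ;; Read 13 13 ;;
  Add 12 13 12 ;; Add 12 2 12 ;; Read 12 12 ;;
  When 12 (Write 9 12 ;; Add 9 2 9).

(** Event addresses are positive, so a cell 0 at the front signals an empty queue. *)
Definition sched_body : cmd :=
  Read 5 10 ;;
  When 10 (
    Add 10 7 11 ;; Write 11 2 ;; Add 10 3 11 ;; Read 11 11 ;;
    Add 11 7 12 ;; Read 12 12 ;;
    When 12 (push 10 ;; push 11)) ;;
  Add 5 2 5 ;; Sub 4 2 4.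

Definition sched : cmd :=
  Add 8 3 5 ;; Add 15 14 4 ;; While 4 sched_body ;;
  Add 8 3 10 ;; Sub 9 10 10 ;; Sub 15 10 0.

(** Truncated subtraction in both directions yields a distance, and 1 minus a distance is nonzero
    only for equal threads. Previous contents of the partner cells count as defects as well.
    [to_ptr] multiplies by 5, the number of cells per event. *)
Definition match_body : cmd :=
  let differ := Sub 12 13 6 ;; Sub 13 12 12 ;; Add 6 12 12 in
  let to_ptr x y := Add x x y ;; Add y y y ;; Add y x x ;; Add x 3 x in
  Read 5 10 ;; Add 5 2 5 ;; Read 5 11 ;; Add 5 2 5 ;;
  to_ptr 10 12 ;; to_ptr 11 12 ;;
  Read 10 12 ;; Read 11 13 ;; differ ;; Sub 2 12 12 ;; Add 0 12 0 ;;
  Add 10 17 12 ;; Read 12 12 ;; Add 11 17 13 ;; Read 13 13 ;; differ ;; Add 0 12 0 ;;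
  Add 10 3 12 ;; Read 12 13 ;; Add 0 13 0 ;;
  Add 11 3 13 ;; Read 13 6 ;; Add 0 6 0 ;;
  Write 12 11 ;; Write 13 10 ;; Sub 4 2 4.

Definition match_pairs : cmd := Add 1 14 4 ;; Cst 17 3 ;; While 4 match_body.

(** The guard is 1 minus the rank, nonzero only for the first event of a thread. *)
Definition events_body : cmd :=
  Read 5 10 ;; Add 10 8 10 ;; Read 10 10 ;; Add 5 16 11 ;; Read 11 11 ;;
  Add 10 11 10 ;; Write 10 5 ;; Sub 2 11 11 ;;
  When 11 (Write 9 5 ;; Add 9 2 9) ;;
  Add 5 16 5 ;; Add 5 2 5 ;; Sub 4 2 4.

Definition index_events : cmd :=
  Add 3 14 5 ;; Add 15 14 4 ;; Cst 16 4 ;; While 4 events_body.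

(** There is no multiplication instruction, so row addresses are accumulated by addition and
    stored. *)
Definition make_rows : cmd :=
  Add 3 3 7 ;; Add 7 7 8 ;; Add 8 3 8 ;; Add 8 3 9 ;; Add 9 3 6 ;;
  Add 8 14 5 ;; Add 15 14 4 ;;
  While 4 (Write 5 6 ;; Add 5 2 5 ;; Add 6 3 6 ;; Sub 4 2 4).

(** Cells 2 to 17 have been moved by [save_input]. The size test having succeeded, [n] is recovered
    as [2 r]. The [6 n] iterations run past the end of the input and copy zeros there. *)
Definition copy_input : cmd :=
  Cst 14 0 ;; Add 1 1 15 ;; Cst 5 18 ;; Cst 16 16 ;; Add 3 16 6 ;;
  Add 15 15 4 ;; Add 4 15 4 ;; Add 4 4 4 ;;
  While 4 (Read 5 10 ;; Write 6 10 ;; Add 5 2 5 ;; Add 6 2 6 ;; Sub 4 2 4).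

Definition main : cmd :=
  copy_input ;; make_rows ;; index_events ;; match_pairs ;;
  Sub 2 0 10 ;; When 10 sched.

(** Register 0 stands at [A + 15] here. The test compares [64 n] with [128 r]; no loop precedes it,
    so a huge [rf] is rejected in constant time. *)
Definition check_size : cmd :=
  Cst 3 15 ;; Sub 0 3 3 ;; Add 1 1 4 ;; Add 4 4 4 ;; Add 4 4 4 ;; Add 4 4 4 ;;
  Add 4 4 4 ;; Add 4 4 4 ;; Add 4 4 4 ;;
  Sub 3 4 5 ;; Sub 4 3 6 ;; Add 5 6 0 ;; Sub 2 0 5 ;; When 5 main.

(** The registers still hold input, so the address [64 n] is built by doubling register 0 in place,
    and register 2 receives the constant 1 only once its content is saved. *)
Definition save_input : cmd :=
  Add 0 0 0 ;; Add 0 0 0 ;; Add 0 0 0 ;; Add 0 0 0 ;; Add 0 0 0 ;; Add 0 0 0 ;;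
  Write 0 2 ;; Cst 2 1 ;;
  foldr (fun j c => Add 0 2 0 ;; Write 0 j ;; c) check_size (iota 3 15).

(** If [n = 0], register 0 already reads as zero defects. The last two instructions turn zero
    defects into acceptance. *)
Definition program : cmd := When 0 save_input ;; Cst 1 1 ;; Sub 1 0 0.

(** * Symbolic execution of commands *)

Ltac reg R i := eval cbn [nth] in (nth 0 R i).
Ltac setreg R d v := eval cbn [set_nth] in (set_nth 0 R d v).

Ltac solve_addr :=
  rewrite /nreg; repeat match goal with x := _ |- _ => clearbody x end; try lia.

Section WpRules.
Variables (N : nat) (Q : seq nat -> (nat -> nat) -> Prop) (R : seq nat) (H : nat -> nat).

Lemma wp_seq c1 c2 : wp N c1 (wp N c2 Q) R H -> wp N (c1 ;; c2) Q R H.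
Proof. by []. Qed.

Lemma wp_cst d v R' : set_nth 0 R d v = R' -> Q R' H -> wp N (Cst d v) Q R H.
Proof. by move=> <-. Qed.

Lemma wp_add a b d x y v R' : nth 0 R a = x -> nth 0 R b = y -> x + y = v ->
  set_nth 0 R d v = R' -> Q R' H -> wp N (Add a b d) Q R H.
Proof. by move=> <- <- <- <-. Qed.

Lemma wp_sub a b d x y R' : nth 0 R a = x -> nth 0 R b = y ->
  set_nth 0 R d (x - y) = R' -> Q R' H -> wp N (Sub a b d) Q R H.
Proof. by move=> <- <- <-. Qed.

Lemma wp_load a d x v R' : nth 0 R a = x -> H x = v -> set_nth 0 R d v = R' ->
  nreg <= x -> Q R' H -> wp N (Read a d) Q R H.
Proof. by move=> <- <- <-. Qed.

Lemma wp_store a b x y : nth 0 R a = x -> nth 0 R b = y ->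
  nreg <= x -> Q R (upd H x y) -> wp N (Write a b) Q R H.
Proof. by move=> <- <-. Qed.

Lemma wp_when a c x : nth 0 R a = x -> (x = 0 -> Q R H) /\ (x <> 0 -> wp N c Q R H) ->
  wp N (When a c) Q R H.
Proof. by move=> <-. Qed.
End WpRules.

Opaque wp.

(* Symbolic execution; the values of sums and heap cells are simplified with
   the equations found in the context. *)
Ltac exec1 :=
  lazymatch goal with
  | |- wp ?N (Seq ?c1 ?c2) ?Q ?R ?H => refine (@wp_seq N Q R H c1 c2 _)
  | |- wp ?N (Cst ?d ?v) ?Q ?R ?H =>
      let R' := setreg R d v in refine (@wp_cst N Q R H d v R' erefl _)
  | |- wp ?N (Add ?a ?b ?d) ?Q ?R ?H =>
      let x := reg R a in let y := reg R b in let w := constr:(x + y) in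
      match goal with
      | e : ?u = ?v |- _ =>
          constr_eq u w; let R' := setreg R d v in
          refine (@wp_add N Q R H a b d x y v R' erefl erefl e erefl _)
      | _ =>
          let R' := setreg R d w in
          refine (@wp_add N Q R H a b d x y w R' erefl erefl erefl erefl _)
      end
  | |- wp ?N (Sub ?a ?b ?d) ?Q ?R ?H =>
      let x := reg R a in let y := reg R b in let R' := setreg R d (x - y) in
      refine (@wp_sub N Q R H a b d x y R' erefl erefl erefl _)
  | |- wp ?N (Read ?a ?d) ?Q ?R ?H =>
      let x := reg R a in let w := constr:(H x) in
      match goal with
      | e : ?u = ?v |- _ =>
          constr_eq u w; let R' := setreg R d v in
          refine (@wp_load N Q R H a d x v R' erefl e erefl _ _); [solve_addr | ]
      | _ =>
          let R' := setreg R d w in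
          refine (@wp_load N Q R H a d x w R' erefl erefl erefl _ _); [solve_addr | ]
      end
  | |- wp ?N (Write ?a ?s) ?Q ?R ?H =>
      let x := reg R a in let y := reg R s in
      refine (@wp_store N Q R H a s x y erefl erefl _ _); [solve_addr | ]
  | |- wp ?N (When ?a ?c) ?Q ?R ?H =>
      let x := reg R a in refine (@wp_when N Q R H a c x erefl _)
  end.

Ltac exec := repeat exec1.

Ltac same_regs :=
  repeat (apply: f_equal2; [first [reflexivity | rewrite ?/nreg /=; lia]|]); reflexivity.

(** * Specifications of the phases of the program *)

Section Run.
Variables (E ord : seq event) (po : rel event) (rf : seq (event * event)).
Variables (tn : nat -> nat) (inp : nat -> nat) (n r A : nat).
Local Notation rk := (po_rank E po).

Definition ptr e := A + 5 * index e ord.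

(** As [18 + 6 n <= 64 n] for positive [n], the cells read stay below [A] and are never overwritten
    by the copy. *)
Lemma copy_ok (N : nat) Q R H :
    0 < n -> A = 64 * n -> r + r = n -> 6 * n <= N ->
    (forall a, 2 + 6 * n <= a -> inp a = 0) ->
    size R = nreg -> nth 0 R 0 = 0 -> nth 0 R 1 = r -> nth 0 R 2 = 1 -> nth 0 R 3 = A ->
    (forall a, nreg <= a -> a < A -> H a = inp a) ->
    (forall a, A <= a -> H a = if a < A + 16 then inp (a - A + 2) else 0) ->
    (forall H' x4 x5 x6 x7 x8 x9 x10 x11 x12 x13 x16 x17,
       (forall a, A <= a -> H' a = inp (a - A + 2)) ->
       Q [:: 0; r; 1; A; x4; x5; x6; x7; x8; x9; x10; x11; x12; x13; 0; n; x16; x17] H') ->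
  wp N copy_input Q R H.
Proof.
move=> n0 hA hr hN inp0.
case: R => [|? [|? [|? [|? [|? [|? [|? [|? [|? [|? [|? [|? [|? [|? [|? [|? [|? [|? [|? ?]]]]]]]]]]]]]]]]]]] //.
move=> _ /= -> -> -> -> Hlow Hhigh post.
rewrite /copy_input; exec.
apply: (@wp_while _ _ _ (fun i R H => exists x7 x8 x9 x10 x11 x12 x13 x17,
  [/\ R = [:: 0; r; 1; A; 6 * n - i; 18 + i; A + 16 + i; x7; x8; x9; x10; x11; x12; x13; 0; n; 16; x17],
      forall a, nreg <= a -> a < A -> H a = inp a &
      forall a, A <= a -> H a = if a < A + 16 + i then inp (a - A + 2) else 0]) _ (6 * n)); first exact: hN.
- do 8 eexists; split; [|exact: Hlow|by move=> a /Hhigh ->; rewrite addn0].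
  same_regs.
- move=> i R' H' iN [x7 [x8 [x9 [x10 [x11 [x12 [x13 [x17 [-> low high]]]]]]]]].
  split; first by rewrite /=; lia.
  exec; split=> //; do 8 eexists; split.
  + same_regs.
  + by move=> a a18 aA; rewrite /upd ifN ?low //; apply/eqP; lia.
  + move=> a aA; rewrite /upd; case: eqP => [->|ne].
      rewrite low; [|rewrite /nreg; lia|lia].
      by rewrite ifT; [congr inp|]; lia.
    by rewrite high //; do 2 case: ifP => //; lia.
move=> R' H' [x7 [x8 [x9 [x10 [x11 [x12 [x13 [x17 [-> low high]]]]]]]]].
split; first by rewrite /=; lia.
apply: post => a aA; rewrite high //; case: ltnP => // ?.
by rewrite inp0 //; lia.
Qed.

Lemma rows_ok (N : nat) Q H x4 x5 x6 x7 x8 x9 x10 x11 x12 x13 x16 x17 :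
    0 < n -> A = 64 * n -> n <= N ->
    (forall a, 2 + 6 * n <= a -> inp a = 0) ->
    (forall a, A <= a -> H a = inp (a - A + 2)) ->
    (forall H' x4 x5 x6 x10 x11 x12 x13 x16 x17,
       (forall a, A <= a -> a < 2 * A -> H' a = inp (a - A + 2)) ->
       (forall j, j < n -> H' (5 * A + j) = 7 * A + j * A) ->
       (forall a, 2 * A <= a -> ~~ (5 * A <= a < 6 * A) -> H' a = 0) ->
       Q [:: 0; r; 1; A; x4; x5; x6; 2 * A; 5 * A; 6 * A; x10; x11; x12; x13; 0; n; x16; x17] H') ->
  wp N make_rows Q [:: 0; r; 1; A; x4; x5; x6; x7; x8; x9; x10; x11; x12; x13; 0; n; x16; x17] H.
Proof.
move=> n0 hA hN inp0 HA post; rewrite /make_rows; exec.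
apply: (@wp_while _ _ _ (fun i R H => exists x10 x11 x12 x13 x16 x17,
  [/\ R = [:: 0; r; 1; A; n - i; 5 * A + i; 7 * A + i * A; 2 * A; 5 * A; 6 * A;
             x10; x11; x12; x13; 0; n; x16; x17],
      forall a, A <= a -> a < 2 * A -> H a = inp (a - A + 2),
      forall j, j < i -> H (5 * A + j) = 7 * A + j * A &
      forall a, 2 * A <= a -> ~~ (5 * A <= a < 6 * A) -> H a = 0]) _ n); first exact: hN.
- do 6 eexists; split=> //; first by same_regs.
    by move=> a aA _; exact: HA.
  by move=> a a2 _; rewrite HA ?inp0; lia.
- move=> i R' H' iN [y10 [y11 [y12 [y13 [y16 [y17 [-> cop rows zero]]]]]]].
  split; first by rewrite /=; lia.
  exec; split=> //; do 6 eexists; split.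
  + same_regs.
  + by move=> a aA a2; rewrite /upd ifN ?cop //; apply/eqP; lia.
  + move=> j ji; rewrite /upd eqn_add2l; case: eqP => [-> //|ne].
    by rewrite rows //; lia.
  + by move=> a aA a2; rewrite /upd ifN ?zero //; apply/eqP; lia.
move=> R' H' [y10 [y11 [y12 [y13 [y16 [y17 [-> cop rows zero]]]]]]].
split; first by rewrite /=; lia.
exact: post.
Qed.

(** [last 0] mirrors the memory: later writes override earlier ones, and an untouched cell holds
    0. *)
Definition row_entry (s : seq event) t k :=
  last 0 [seq ptr e | e <- s & (tn (thr e) == t) && (rk e == k)].

Definition heads (s : seq event) := [seq e <- s | rk e == 0].

(** The range of [j] extends beyond the queue: the default of [nth] records that the cells past the
    tail are 0. *)
Definition holds_queue (H : nat -> nat) (q : seq event) :=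
  forall j, j < A -> H (6 * A + j) = nth 0 (map ptr q) j.

Lemma row_entry_rcons s e t k : row_entry (rcons s e) t k =
  if (tn (thr e) == t) && (rk e == k) then ptr e else row_entry s t k.
Proof.
rewrite /row_entry filter_rcons; case: ifP => // _.
by rewrite map_rcons last_rcons.
Qed.

(** Row and rank are quotient and remainder of the division by [A]. *)
Lemma eq_row_address t k t' k' : k < A -> k' < A ->
  (t * A + k == t' * A + k') = (t == t') && (k == k').
Proof.
move=> kA kA'; apply/eqP/andP => [eqa|[/eqP-> /eqP->]] //.
have A0 : 0 < A by apply: leq_ltn_trans kA.
have := congr1 (divn^~ A) eqa; have := congr1 (modn^~ A) eqa.
by rewrite !divnMDl // !modnMDl !modn_small // !divn_small // !addn0 => -> ->.
Qed.

Lemma holds_queue_rcons H q e : holds_queue H q -> size q < A ->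
  holds_queue (upd H (6 * A + size q) (ptr e)) (rcons q e).
Proof.
move=> Hq qA j jA; rewrite /upd eqn_add2l map_rcons nth_rcons size_map.
case: ltngtP => // jq; rewrite Hq // nth_default // size_map ltnW //.
Qed.

Lemma holds_queue_upd H q a v : holds_queue H q -> ~~ (6 * A <= a < 7 * A) ->
  holds_queue (upd H a v) q.
Proof. by move=> Hq aA j jA; rewrite /upd ifN ?Hq //; apply/eqP; lia. Qed.

Definition fields_ok := forall i, i < n -> let e := nth e0 ord i in
  [/\ inp (5 * i + 2) = tn (thr e), inp (5 * i + 5) = value e,
      inp (5 * i + 6) = rk e, rk e <= n & tn (thr e) < n].

Definition indexed (H : nat -> nat) := [/\
  forall a, A <= a -> a < 2 * A -> H a = inp (a - A + 2),
  forall j, j < n -> H (5 * A + j) = 7 * A + j * A &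
  forall t k, k < A -> H (7 * A + t * A + k) = row_entry ord t k].

Lemma events_ok (N : nat) Q H x4 x5 x6 x10 x11 x12 x13 x16 x17 :
    0 < n -> A = 64 * n -> n <= N -> size ord = n -> uniq ord -> fields_ok ->
    (forall a, A <= a -> a < 2 * A -> H a = inp (a - A + 2)) ->
    (forall j, j < n -> H (5 * A + j) = 7 * A + j * A) ->
    (forall a, 2 * A <= a -> ~~ (5 * A <= a < 6 * A) -> H a = 0) ->
    (forall H' x4 x6 x10 x11 x12 x13 x17,
       indexed H' -> (forall a, 2 * A <= a -> a < 5 * A -> H' a = 0) ->
       holds_queue H' (heads ord) ->
       Q [:: 0; r; 1; A; x4; A + 5 * n; x6; 2 * A; 5 * A; 6 * A + size (heads ord);
           x10; x11; x12; x13; 0; n; 4; x17] H') ->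
  wp N index_events Q
    [:: 0; r; 1; A; x4; x5; x6; 2 * A; 5 * A; 6 * A; x10; x11; x12; x13; 0; n; x16; x17] H.
Proof.
move=> n0 hA hN so uo fok Hcop Hrows Hzero post; rewrite /index_events; exec.
apply: (@wp_while _ _ _ (fun i R H => exists x6 x10 x11 x12 x13 x17,
  [/\ R = [:: 0; r; 1; A; n - i; A + 5 * i; x6; 2 * A; 5 * A; 6 * A + size (heads (take i ord));
             x10; x11; x12; x13; 0; n; 4; x17],
      forall a, 2 * A <= a -> a < 5 * A -> H a = 0,
      (forall a, A <= a -> a < 2 * A -> H a = inp (a - A + 2)) /\
      (forall j, j < n -> H (5 * A + j) = 7 * A + j * A),
      forall t k, k < A -> H (7 * A + t * A + k) = row_entry (take i ord) t k &
      holds_queue H (heads (take i ord))]) _ n); first exact: hN.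
- do 6 eexists; rewrite take0; split=> //; first by same_regs.
  + by move=> a a2 a5; apply: Hzero; lia.
  + by move=> t k kA; apply: Hzero; lia.
  + by move=> j jA; rewrite nth_nil; apply: Hzero; lia.
- move=> i R' H' iN [y6 [y10 [y11 [y12 [y13 [y17 [-> zero [cop rows] ent hq]]]]]]].
  split; first by rewrite /=; lia.
  have [ft fv fr rkn tnn] := fok _ iN; set e := nth e0 ord i in ft fv fr rkn tnn.
  have pe : ptr e = A + 5 * i by rewrite /ptr index_uniq // so.
  have tk : take i.+1 ord = rcons (take i ord) e by rewrite (take_nth e0) // so.
  have hqA : size (heads (take i ord)) <= i.
    by rewrite size_filter; apply: leq_trans (count_size _ _) _; rewrite size_takel // so ltnW.
  have h1 : H' (A + 5 * i) = tn (thr e).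
    by rewrite cop; [rewrite -ft; congr inp|..]; lia.
  have h2 : H' (A + 5 * i + 4) = rk e.
    by rewrite cop; [rewrite -fr; congr inp|..]; lia.
  have h3 := rows _ tnn.
  rewrite /events_body; set Q' := (X in wp _ _ X).
  (* [exec] matches sums syntactically, and the program adds the row base to the thread number in
     this order. *)
  rewrite [5 * A + _]addnC in h3; exec.
  set H1 := upd H' _ _.
  have tA : 7 * A + tn (thr e) * A + rk e >= 7 * A by rewrite -addnA leq_addr.
  have f1 a : a < 7 * A -> H1 a = H' a.
    by move=> a7; rewrite /H1 /upd ifN //; apply/eqP; lia.
  have inv2 : forall a, 2 * A <= a -> a < 5 * A -> H1 a = 0.
    by move=> a a2 a5; rewrite f1 ?zero //; lia.
  have inv3 : (forall a, A <= a -> a < 2 * A -> H1 a = inp (a - A + 2)) /\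
      (forall j, j < n -> H1 (5 * A + j) = 7 * A + j * A).
    by split=> [a aA a2|j jn]; rewrite f1; [exact: cop|lia|exact: rows|lia].
  have inv4 : forall t k, k < A -> H1 (7 * A + t * A + k) = row_entry (take i.+1 ord) t k.
    move=> t k kA; rewrite tk row_entry_rcons /H1 /upd -!(addnA (7 * A)) eqn_add2l eq_row_address //.
      rewrite [t == _]eq_sym [k == _]eq_sym pe; case: ifP => // _.
      by rewrite addnA ent.
    by lia.
  have inv5 : holds_queue H1 (heads (take i ord)) by apply: holds_queue_upd => //; lia.
  have hd : heads (take i.+1 ord) =
      if rk e == 0 then rcons (heads (take i ord)) e else heads (take i ord).
    by rewrite tk /heads filter_rcons.
  split=> rke; exec; rewrite {}/Q'; split=> //; do 6 eexists; split.
  + rewrite hd ifN; last by lia.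
    same_regs.
  + exact: inv2.
  + exact: inv3.
  + exact: inv4.
  + by rewrite hd ifN //; lia.
  + rewrite hd ifT; last by lia.
    by rewrite size_rcons; same_regs.
  + by move=> a a2 a5; rewrite /upd ifN ?inv2 //; apply/eqP; lia.
  + by split=> [a aA a2|j jn]; rewrite /upd ifN; [exact: (proj1 inv3)|apply/eqP; lia|exact: (proj2 inv3)|apply/eqP; lia].
  + move=> t k kA; rewrite -inv4 // /upd ifN //; apply/eqP.
    by have := leq_addr (t * A + k) (7 * A); lia.
  + rewrite hd ifT; last by lia.
    by rewrite -pe; apply: holds_queue_rcons => //; lia.
move=> R' H' [y6 [y10 [y11 [y12 [y13 [y17 [-> zero [cop rows] ent hq]]]]]]].
rewrite take_oversize ?so // in ent hq *.
split; first by rewrite /=; lia.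
by apply: post.
Qed.

Lemma indexed_upd H a v : indexed H -> 2 * A <= a -> (a < 5 * A) || (6 * A <= a < 7 * A) ->
  n < A -> indexed (upd H a v).
Proof.
move=> [cop rows ent] a2 a5 nA; split.
- by move=> b bA b2; rewrite /upd ifN ?cop //; apply/eqP; lia.
- by move=> j jn; rewrite /upd ifN ?rows //; apply/eqP; lia.
move=> t k kA; rewrite -ent // /upd ifN //; apply/eqP.
by have := leq_addr (t * A + k) (7 * A); lia.
Qed.

Lemma ptr_inj : {in ord &, injective ptr}.
Proof.
move=> e f eo fo; rewrite /ptr => pef.
by rewrite -(nth_index e0 eo) -(nth_index e0 fo); congr nth; lia.
Qed.

Lemma indexed_fields H e : indexed H -> fields_ok -> A = 64 * n -> size ord = n -> e \in ord ->
  [/\ H (ptr e) = tn (thr e), H (ptr e + 3) = value e, H (ptr e + 4) = rk e,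
      rk e <= n & tn (thr e) < n].
Proof.
move=> [cop _ _] fok hA so eo; have io : index e ord < n by rewrite -so index_mem.
have [ft fv fr] := fok _ io; rewrite nth_index // in ft fv fr *.
move=> ? ?; split=> //; rewrite /ptr cop; try lia.
- by rewrite -ft; congr inp; lia.
- by rewrite -fv; congr inp; lia.
- by rewrite -fr; congr inp; lia.
Qed.

Lemma ptr_bounds e : e \in ord -> size ord = n -> A <= ptr e <= A + 5 * n - 5.
Proof.
move=> eo so; have : index e ord < n by rewrite -so index_mem.
by rewrite /ptr; lia.
Qed.

Definition pairs_ok := forall j, j < r -> let p := nth (e0, e0) rf j in
  [/\ p.1 \in ord, p.2 \in ord, p.1 != p.2,
      inp (5 * n + 2 * j + 2) = index p.1 ord & inp (5 * n + 2 * j + 3) = index p.2 ord].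

(** The left side is the value [match_body] leaves in register 0; [m] and [m'] are the former
    partner cells. *)
Lemma penalty_eq0 b t t' v v' m m' :
  (b + (1 - (t - t' + (t' - t))) + (v - v' + (v' - v)) + m + m' == 0) =
  [&& b == 0, (t != t') && (v == v'), m == 0 & m' == 0].
Proof. lia. Qed.

Lemma match_ok (N : nat) Q H x4 x6 x10 x11 x12 x13 x17 qt :
    0 < n -> A = 64 * n -> n <= N -> size ord = n -> r + r = n -> size rf = r ->
    fields_ok -> pairs_ok ->
    {in ord &, forall e f, (tn (thr e) == tn (thr f)) = (thr e == thr f)} ->
    indexed H -> (forall a, 2 * A <= a -> a < 5 * A -> H a = 0) ->
    holds_queue H (heads ord) ->
    (forall H' x0 x4 x5 x6 x10 x11 x12 x13,
       (x0 = 0 <-> good rf) -> indexed H' -> holds_queue H' (heads ord) ->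
       (forall a, 3 * A <= a -> a < 5 * A -> H' a = 0) ->
       (forall e, e \in ord -> H' (ptr e + A) = oapp ptr 0 (mate rf e)) ->
       Q [:: x0; r; 1; A; x4; x5; x6; 2 * A; 5 * A; qt;
           x10; x11; x12; x13; 0; n; 4; 3] H') ->
  wp N match_pairs Q
    [:: 0; r; 1; A; x4; A + 5 * n; x6; 2 * A; 5 * A; qt; x10; x11; x12; x13; 0; n; 4; x17] H.
Proof.
move=> n0 hA hN so hr srf fok pok tni Hidx Hzero Hq post; rewrite /match_pairs; exec.
apply: (@wp_while _ _ _ (fun j R H => exists x0 x6 x10 x11 x12 x13,
  [/\ R = [:: x0; r; 1; A; r - j; A + 5 * n + 2 * j; x6; 2 * A; 5 * A; qt;
             x10; x11; x12; x13; 0; n; 4; 3],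
      x0 = 0 <-> good (take j rf),
      indexed H /\ holds_queue H (heads ord),
      forall a, 3 * A <= a -> a < 5 * A -> H a = 0 &
      forall e, e \in ord -> H (ptr e + A) = oapp ptr 0 (mate (take j rf) e)]) _ r).
- by lia.
- exists 0; do 5 eexists; rewrite take0; split=> //; first by same_regs.
    by move=> a a3 a5; apply: Hzero; lia.
  by move=> e /ptr_bounds/(_ so) ?; apply: Hzero; lia.
- move=> j R' H' jr [y0 [y6 [y10 [y11 [y12 [y13 [-> hy0 [idx hq] zero part]]]]]]].
  split; first by rewrite /=; lia.
  have := pok _ jr; set p := nth _ _ j => -[p1 p2 p12 ip1 ip2].
  have tk : take j.+1 rf = rcons (take j rf) p by rewrite (take_nth (e0, e0)) // srf.
  have [cop _ _] := idx.
  have r1 : H' (A + 5 * n + 2 * j) = index p.1 ord.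
    by rewrite cop; [rewrite -ip1; congr inp|..]; lia.
  have r2 : H' (A + 5 * n + 2 * j + 1) = index p.2 ord.
    by rewrite cop; [rewrite -ip2; congr inp|..]; lia.
  have pE e : index e ord + index e ord + (index e ord + index e ord) + index e ord + A = ptr e.
    by rewrite /ptr; lia.
  have pE1 := pE p.1; have pE2 := pE p.2.
  have [t1 v1 _ _ _] := indexed_fields idx fok hA so p1.
  have [t2 v2 _ _ _] := indexed_fields idx fok hA so p2.
  have b1 := ptr_bounds p1 so; have b2 := ptr_bounds p2 so.
  have m1 := part _ p1; have m2 := part _ p2.
  rewrite /match_body; set Q' := (X in wp _ _ X).
  exec.
  rewrite {}/Q'; split=> //; do 6 eexists; split.
  + same_regs.
  + rewrite tk good_rcons // /admissible -tni //.
    (* Addresses are positive, so a partner cell 0 faithfully encodes [None]. *)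
    have o0 m : (oapp ptr 0 m == 0) = (m == None) by case: m => [e|] //=; apply/negbTE; rewrite /ptr; lia.
    rewrite -!o0; split=> [/eqP|H0]; first by rewrite penalty_eq0 => /and4P[/eqP/hy0 -> -> -> ->].
    by apply/eqP; rewrite penalty_eq0; case/andP: H0 => /hy0 -> ->.
  + split; first by do 2 (apply: indexed_upd; [|lia..]).
    by do 2 (apply: holds_queue_upd; [|lia]).
  + by move=> a a3 a5; rewrite /upd !ifN ?zero //; apply/eqP; lia.
  move=> e eo; rewrite tk mate_rcons /upd !eqn_add2r.
  rewrite !(inj_in_eq ptr_inj) //.
  by case: ifP => // _; case: ifP => // _; exact: part.
move=> R' H' [y0 [y6 [y10 [y11 [y12 [y13 [-> hy0 [idx hq] zero part]]]]]]].
split; first by rewrite /=; lia.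
by rewrite take_oversize ?srf // in hy0 part; apply: post.
Qed.

(** The two filters traverse [ord] and [E] in different orders, but a list of at most one element
    has only one order. *)
Lemma row_entry_succs e : abstract_execution E po -> perm_eq ord E ->
    {in ord &, forall e f, (tn (thr e) == tn (thr f)) = (thr e == thr f)} ->
    e \in ord ->
  row_entry ord (tn (thr e)) (rk e).+1 = last 0 (map ptr (succs E po e)).
Proof.
move=> hE hord tni eo; have eE : e \in E by rewrite -(perm_mem hord).
rewrite /row_entry; congr (last _ (map _ _)).
apply: perm_small_eq; first exact: size_succs.
apply: uniq_perm; rewrite ?filter_uniq ?(perm_uniq hord) //; try by case: hE.
move=> x; rewrite !mem_filter (perm_mem hord).
by case xE: (x \in E); rewrite ?andbF // !andbT tni // (perm_mem hord).
Qed.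

(** [push] is called on register 10 for the dequeued event and on register 11 for its partner; the
    disjunction covers both calls. *)
Lemma push_ok (N x : nat) Q H e q x0 x4 x5 x6 x10 x11 x12 x13 :
    abstract_execution E po -> perm_eq ord E -> A = 64 * n -> size ord = n -> 0 < n ->
    fields_ok -> {in ord &, forall e f, (tn (thr e) == tn (thr f)) = (thr e == thr f)} ->
    e \in ord -> size q < A -> indexed H -> holds_queue H q ->
    (x, ptr e) = (10, x10) \/ (x, ptr e) = (11, x11) ->
    (forall H' x12 x13, indexed H' -> holds_queue H' (q ++ succs E po e) ->
       (forall a, a < 5 * A -> H' a = H a) ->
       Q [:: x0; r; 1; A; x4; x5; x6; 2 * A; 5 * A; 6 * A + size (q ++ succs E po e);
           x10; x11; x12; x13; 0; n; 4; 3] H') ->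
  wp N (push x) Q
    [:: x0; r; 1; A; x4; x5; x6; 2 * A; 5 * A; 6 * A + size q;
      x10; x11; x12; x13; 0; n; 4; 3] H.
Proof.
move=> hE hord hA so n0 fok tni eo qA idx hq xe post.
have [cop rows ent] := idx; have pb := ptr_bounds eo so.
have [ft _ fr rkn tnn] := indexed_fields idx fok hA so eo.
have hrow := rows _ tnn; rewrite [5 * A + _]addnC in hrow.
have hent : H (7 * A + tn (thr e) * A + rk e + 1) = last 0 (map ptr (succs E po e)).
  by rewrite -row_entry_succs // -ent; [congr H|]; lia.
have eE : e \in E by rewrite -(perm_mem hord).
have go z : wp N (When 12 (Write 9 12 ;; Add 9 2 9)) Q
    [:: x0; r; 1; A; x4; x5; x6; 2 * A; 5 * A; 6 * A + size q;
      x10; x11; last 0 (map ptr (succs E po e)); z; 0; n; 4; 3] H.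
  have := size_succs hE e.
  have sub : {subset succs E po e <= ord}.
    by move=> f; rewrite mem_filter -(perm_mem hord) => /andP[].
  case: (succs E po e) post sub => [|f [|//]] post sub _ /=.
    exec; split=> // _; have := post H 0 z; rewrite cats0; exact.
  have fo : f \in ord by apply: sub; rewrite inE.
  have pf := ptr_bounds fo so.
  exec; split=> [|_]; first by lia.
  exec; have := post (upd H (6 * A + size q) (ptr f)) (ptr f) z.
  rewrite size_cat /= addnA; apply.
  - by apply: indexed_upd => //; lia.
  - by rewrite cats1; exact: holds_queue_rcons.
  - by move=> a a5; rewrite /upd ifN //; apply/eqP; lia.
by rewrite /push; case: xe => -[-> pe]; rewrite pe in ft fr pb; exec; exact: go.
Qed.

Definition marks_ok (H : nat -> nat) (s : seq event) :=
  forall e, e \in ord -> H (ptr e + 2 * A) = (e \in s).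

Lemma sched_ok (N : nat) Q H x4 x5 x6 x10 x11 x12 x13 :
    abstract_execution E po -> perm_eq ord E -> A = 64 * n -> size ord = n -> 0 < n ->
    n <= N -> fields_ok ->
    {in ord &, forall e f, (tn (thr e) == tn (thr f)) = (thr e == thr f)} ->
    good rf -> perm_eq (flat rf) E ->
    indexed H -> holds_queue H (heads ord) ->
    (forall a, 3 * A <= a -> a < 5 * A -> H a = 0) ->
    (forall e, e \in ord -> H (ptr e + A) = oapp ptr 0 (mate rf e)) ->
    (forall H' x4 x5 x6 x10 x11 x12 x13,
       Q [:: n - size (queue E ord po rf n); r; 1; A; x4; x5; x6; 2 * A; 5 * A;
           6 * A + size (queue E ord po rf n); x10; x11; x12; x13; 0; n; 4; 3] H') ->
  wp N sched Q
    [:: 0; r; 1; A; x4; x5; x6; 2 * A; 5 * A; 6 * A + size (heads ord);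
      x10; x11; x12; x13; 0; n; 4; 3] H.
Proof.
move=> hE hord hA so n0 hN fok tni gd rfE Hidx Hq Hzero Hpart post.
have szE : size E = n by rewrite -(perm_size hord).
have szq k : size (queue E ord po rf k) <= n by rewrite -szE; exact: size_queue.
have ordE e : (e \in ord) = (e \in E) by rewrite (perm_mem hord).
have mtO e : e \in ord -> mt rf e \in ord.
  by rewrite !ordE => /(mtP gd rfE)[].
rewrite /sched; exec.
apply: (@wp_while _ _ _ (fun k R H => exists x6 x10 x11 x12 x13,
  [/\ R = [:: 0; r; 1; A; n - k; 6 * A + k; x6; 2 * A; 5 * A;
             6 * A + size (queue E ord po rf k); x10; x11; x12; x13; 0; n; 4; 3],
      indexed H, holds_queue H (queue E ord po rf k),
      marks_ok H (take k (queue E ord po rf k)) &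
      forall e, e \in ord -> H (ptr e + A) = ptr (mt rf e)]) _ n).
- exact: hN.
- do 5 eexists; split=> //; first by same_regs.
    by move=> e eo; have ? := ptr_bounds eo so; rewrite take0 Hzero //; lia.
  move=> e eo; rewrite Hpart // /mt.
  by have := mate_mem rf e; rewrite (perm_mem rfE) -ordE eo; case: mate.
- move=> k R' H' kn [y6 [y10 [y11 [y12 [y13 [-> idx hq mk part]]]]]].
  split; first by rewrite /=; lia.
  set q := queue E ord po rf k in hq mk *.
  have qn : size q <= n := szq k.
  have hqk : H' (6 * A + k) = nth 0 (map ptr q) k by apply: hq; lia.
  rewrite /sched_body; set Q' := (X in wp _ _ X).
  (* Restates the end of a round once for its three outcomes: empty queue, pair fired, pair still
     waiting. *)
  have Q'S H1 z4 z5 z6 z10 z11 z12 z13 :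
      z4 = n - k.+1 -> z5 = 6 * A + k.+1 -> indexed H1 ->
      holds_queue H1 (queue E ord po rf k.+1) ->
      marks_ok H1 (take k.+1 (queue E ord po rf k.+1)) ->
      (forall e, e \in ord -> H1 (ptr e + A) = ptr (mt rf e)) ->
      Q' [:: 0; r; 1; A; z4; z5; z6; 2 * A; 5 * A;
             6 * A + size (queue E ord po rf k.+1); z10; z11; z12; z13; 0; n; 4; 3] H1.
    by move=> -> -> *; split=> //; do 5 eexists; split.
  clearbody Q'.
  have [qk|kq] := leqP (size q) k.
    rewrite nth_default ?size_map // in hqk.
    exec; split=> [_|/(_ erefl) //]; exec.
    have qS : queue E ord po rf k.+1 = q by rewrite /= /enqueue -/q ltnNge qk.
    have := Q'S H' (n - k - 1) (6 * A + k + 1) y6 0 y11 y12 y13.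
    rewrite qS; apply=> //; try lia.
    by move: mk; rewrite !take_oversize // ltnW.
  rewrite (nth_map e0 0 ptr kq) in hqk.
  set e := nth e0 q k in hqk.
  have qinv := queue_invP hE hord gd rfE k.
  have eo : e \in ord by rewrite ordE; apply: (queue_sub qinv); exact: mem_nth.
  have mo := mtO _ eo.
  have be := ptr_bounds eo so; have bm := ptr_bounds mo so.
  have pe := part _ eo.
  have qS : queue E ord po rf k.+1 = if mt rf e \in take k.+1 q
      then q ++ succs E po e ++ succs E po (mt rf e) else q.
    by rewrite /= /enqueue -/q kq.
  exec; split=> [|_]; first by lia.
  do 4 exec1.
  set H1 := upd H' _ _.
  have idx1 : indexed H1 by apply: indexed_upd => //; lia.
  have hq1 : holds_queue H1 q by apply: holds_queue_upd => //; lia.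
  have f1 a : a < 3 * A -> H1 a = H' a.
    by move=> a3; rewrite /H1 /upd ifN //; apply/eqP; lia.
  have part1 d : d \in ord -> H1 (ptr d + A) = ptr (mt rf d).
    by move=> dO; have bd := ptr_bounds dO so; rewrite f1 ?part //; lia.
  have mk1 : marks_ok H1 (take k.+1 q).
    move=> d dO; rewrite /H1 /upd eqn_add2r (inj_in_eq ptr_inj) // (take_nth e0) //.
    by rewrite mem_rcons inE -/e; case: eqP => //= _; exact: mk.
  have pe1 := part1 _ eo; have me1 := mk1 _ mo.
  clearbody H1; move: qS me1.
  case: (mt rf e \in take k.+1 q) => qS me1; rewrite /= in me1.
  - exec; split=> [|_]; first by lia.
    exec1.
    apply: (@push_ok N 10 _ H1 e q) => //; first by lia.
      by left.
    move=> H2 z12 z13 idx2 hq2 f2.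
    (* The intermediate queue is a prefix of the next one, which bounds its length. *)
    have sz2 : size (q ++ succs E po e) <= n.
      apply: leq_trans (szq k.+1); rewrite qS !size_cat; lia.
    apply: (@push_ok N 11 _ H2 (mt rf e)) => //; first by lia.
      by right.
    move=> H3 w12 w13 idx3 hq3 f3; rewrite -catA -qS in hq3 *.
    exec; apply: Q'S => //; try lia.
      move=> d dO; have bd := ptr_bounds dO so.
      rewrite f3 ?f2 ?mk1 //; try lia.
      by rewrite qS takel_cat.
    move=> d dO; have bd := ptr_bounds dO so.
    by rewrite f3 ?f2 ?part1 //; lia.
  - exec; split=> [_|]; last by [].
    exec; have := Q'S H1 (n - k - 1) (6 * A + k + 1) y6 (ptr e) (ptr (mt rf e)) 0 y13.
    by rewrite qS; apply=> //; lia.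
move=> R' H' [y6 [y10 [y11 [y12 [y13 [-> idx hq mk part]]]]]].
split; first by rewrite /=; lia.
exec.
have -> : forall m, 6 * A + m - (5 * A + A) = m by move=> m; lia.
exact: post.
Qed.
End Run.

(** * Correctness of the whole program *)

Section Correctness.
Variables (E ord : seq event) (po : rel event) (rf : seq (event * event)).
Variables (tn : nat -> nat) (inp : nat -> nat) (n r A N : nat).
Hypotheses (hE : abstract_execution E po) (hrf : rf_instance E rf).
Hypotheses (hord : perm_eq ord E).
Hypothesis tn_inj : {in ord &, forall e f, (tn (thr e) == tn (thr f)) = (thr e == thr f)}.
Hypotheses (szE : size E = n) (szrf : size rf = r).
Hypotheses (inp0 : inp 0 = n) (inp1 : inp 1 = r).
(** Without [r + r = n] the input may reach beyond [A], but such an instance is rejected before any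
    heap cell is read. *)
Hypothesis inp_high : r + r = n -> forall a, 2 + 6 * n <= a -> inp a = 0.
Hypotheses (fok : fields_ok E ord po tn inp n) (pok : pairs_ok ord rf inp n r).
Hypotheses (hA : A = 64 * n) (hN : 6 * n <= N).

Lemma main_ok Q R H : 0 < n -> r + r = n ->
    size R = nreg -> nth 0 R 0 = 0 -> nth 0 R 1 = r -> nth 0 R 2 = 1 -> nth 0 R 3 = A ->
    (forall a, nreg <= a -> a < A -> H a = inp a) ->
    (forall a, A <= a -> H a = if a < A + 16 then inp (a - A + 2) else 0) ->
    (forall R' H', (nth 0 R' 0 = 0 <-> consistent_rf cap_sync E po rf) -> Q R' H') ->
  wp N main Q R H.
Proof.
move=> n0 hr szR R0 R1 R2 R3 low high post.
have so : size ord = n by rewrite (perm_size hord).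
have uo : uniq ord by rewrite (perm_uniq hord); case: hE.
have nN : n <= N by lia.
have inph := inp_high hr.
rewrite /main; exec1.
apply: (copy_ok n0 hA hr hN inph szR R0 R1 R2 R3 low high) => {low high}.
move=> H1 x4 x5 x6 x7 x8 x9 x10 x11 x12 x13 x16 x17 high1; exec1.
eapply rows_ok; [exact n0|exact hA|exact nN|exact inph|exact high1|].
move=> H2 {}x4 {}x5 {}x6 {}x10 {}x11 {}x12 {}x13 {}x16 {}x17 cop rows zero; exec1.
eapply events_ok; [exact n0|exact hA|exact nN|exact so|exact uo|exact fok|exact cop|exact rows|exact zero|].
move=> H3 {}x4 {}x6 {}x10 {}x11 {}x12 {}x13 {}x17 idx {}zero hq; exec1.
eapply match_ok; [exact n0|exact hA|exact nN|exact so|exact hr|exact szrf|exact fok|exact pok|exact tn_inj|exact idx|exact zero|exact hq|].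
move=> H4 x0 {}x4 {}x5 {}x6 {}x10 {}x11 {}x12 {}x13 hgood {}idx {}hq {}zero part.
have consE := consistent_queue hE hrf hord.
have szr2 : (size rf).*2 = size E by rewrite szrf szE -addnn.
exec; split=> [bad|ok].
  have xne : x0 <> 0 by move=> x00; rewrite x00 in bad.
  by apply: post; rewrite consE /=; split=> [//|[_ /hgood]].
have x00 : x0 = 0 by move: ok; clear; lia.
have gd : good rf by apply/hgood.
have rfE := good_perm hE hrf szr2 gd.
rewrite x00.
eapply sched_ok; [exact hE|exact hord|exact hA|exact so|exact n0|exact nN|exact fok|exact tn_inj|exact gd|exact rfE|exact idx|exact hq|exact zero|exact part|].
move=> H5 y4 y5 y6 y10 y11 y12 y13; apply: post; rewrite consE szE /=.
have := size_queue hE hord gd rfE n; rewrite szE => qn.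
split=> [q0|[_ _ ->]]; last by rewrite subnn.
by split; [rewrite szr2|exact: gd|move: q0 qn; clear; lia].
Qed.

Lemma program_ok R H :
    (forall a, nreg <= a -> H a = inp a) -> R = [seq inp a | a <- iota 0 nreg] ->
  wp N program (fun R' _ => nth 0 R' 0 <> 0 <-> consistent_rf cap_sync E po rf) R H.
Proof.
move=> Hhigh ->; rewrite /nreg /= inp0 inp1 /program; exec1.
have consE := consistent_queue hE hrf hord.
set Q := (X in wp _ _ X).
have postQ R' H' : (nth 0 R' 0 = 0 <-> consistent_rf cap_sync E po rf) -> Q R' H'.
  move=> h; rewrite /Q; apply: wp_seq; apply: wp_cst; first by [].
  apply: wp_sub; try reflexivity.
  by rewrite !nth_set_nth /= -h; move: (nth 0 R' 0); clear; lia.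
clearbody Q; exec1; split=> [n0|nn0].
  apply: postQ; rewrite consE /=; split=> // _.
  have E0 : E = [::] by apply: size0nil; rewrite szE.
  have rf0 : rf = [::].
    by case: (rf) hrf => // p s [_ /(_ p)]; rewrite inE eqxx E0 => /(_ isT)[].
  have ord0 : ord = [::] by apply: size0nil; rewrite (perm_size hord) E0.
  by rewrite E0 rf0 ord0.
have n0 : 0 < n by rewrite lt0n; apply/eqP.
(* [exec] rewrites with these equations, which keeps the repeated doublings from expanding into
   large sums. *)
have a1 : n + n = 2 * n by lia.
have a2 : 2 * n + 2 * n = 4 * n by lia.
have a3 : 4 * n + 4 * n = 8 * n by lia.
have a4 : 8 * n + 8 * n = 16 * n by lia.
have a5 : 16 * n + 16 * n = 32 * n by lia.
have a6 : 32 * n + 32 * n = A by lia.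
rewrite /save_input [foldr _ _ _]/=; exec.
set H1 := upd _ _ _.
have low1 : forall a, nreg <= a -> a < A -> H1 a = inp a.
  move=> a a18 aA; rewrite /H1 /upd; do 16 (rewrite ifN; last by apply/eqP; lia).
  exact: Hhigh.
have high1 : r + r = n -> forall a, A <= a -> H1 a = if a < A + 16 then inp (a - A + 2) else 0.
  move=> hr a aA; rewrite /H1 /upd.
  do 16 (case: eqP => [->|?]; first by rewrite ifT; [congr inp|]; lia).
  by rewrite ifN ?Hhigh ?inp_high //; rewrite ?/nreg; lia.
clearbody H1.
have b1 : r + r = 2 * r by lia.
have b2 : 2 * r + 2 * r = 4 * r by lia.
have b3 : 4 * r + 4 * r = 8 * r by lia.
have b4 : 8 * r + 8 * r = 16 * r by lia.
have b5 : 16 * r + 16 * r = 32 * r by lia.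
have b6 : 32 * r + 32 * r = 64 * r by lia.
have b7 : 64 * r + 64 * r = 128 * r by lia.
rewrite /check_size; exec; split=> [bad|ok].
  apply: postQ; rewrite consE /=; split=> [|[]]; first by move: bad; clear; lia.
  by rewrite szrf szE -addnn; lia.
have hr : r + r = n by lia.
by apply: main_ok => //; rewrite /=; [lia|lia|exact: high1].
Qed.
End Correctness.

(** * Decoding of the input and the time bound *)

Lemma size_flatten_blocks (T : Type) (f : T -> seq nat) k s :
  (forall x, size (f x) = k) -> size (flatten (map f s)) = k * size s.
Proof. by move=> fk; elim: s => [|x s IH] /=; rewrite ?muln0 // size_cat fk IH mulnS. Qed.

Lemma nth_flatten_blocks (T : Type) (f : T -> seq nat) k x0 s i j :
  (forall x, size (f x) = k) -> i < size s -> j < k ->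
  nth 0 (flatten (map f s)) (k * i + j) = nth 0 (f (nth x0 s i)) j.
Proof.
move=> fk; elim: s i => [|x s IH] [|i] //= isz jk.
  by rewrite muln0 nth_cat fk jk.
by rewrite nth_cat fk mulnS -addnA -ltn_subRL subnn ltn0 addKn IH.
Qed.

Lemma cost_program N : cost N program <= 1000 * N + 1000.
Proof. rewrite /=; lia. Qed.

Theorem theorem1p9 :
  exists (P : seq instr) (c : nat),
    forall (S : seq event) (po : rel event) (rf : seq (event * event))
           (input : seq nat),
      abstract_execution S po -> rf_instance S rf -> encodes S po rf input ->
      exists t, t <= c * size S + c /\ halted P (run P input t) /\
        (accepts (run P input t) <-> consistent_rf cap_sync S po rf).
Proof.
(* The constant is 1000 times 6: [cost_program] is applied with [N = 6 n], the length of the longest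
   loop, the copying of the input. *)
exists (compile 0 program), 6000 => E po rf input hE hrf.
move=> [ord [tn [cn [hord htn _ hlt hinput]]]].
have ordE e : (e \in ord) = (e \in E) by exact: perm_mem.
have so : size ord = size E by exact: perm_size.
pose f (e : event) :=
  [:: tn (thr e); nat_of_bool (is_snd e); cn (chan e); value e; po_rank E po e].
pose g (p : event * event) := [:: index p.1 ord; index p.2 ord].
pose inp := nth 0 input.
have szf : size (flatten (map f ord)) = 5 * size E by rewrite (size_flatten_blocks (k := 5)) ?so.
have szg : size (flatten (map g rf)) = 2 * size rf by rewrite (size_flatten_blocks (k := 2)).
have inpf i j : i < size E -> j < 5 -> inp (5 * i + j.+2) = nth 0 (f (nth e0 ord i)) j.
  move=> iE j5; rewrite /inp hinput !addnS /= nth_cat szf ifT; last by lia.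
  by rewrite (nth_flatten_blocks e0) ?so.
have inpg i j : i < size rf -> j < 2 ->
    inp (5 * size E + 2 * i + j.+2) = nth 0 (g (nth (e0, e0) rf i)) j.
  move=> irf j2; rewrite /inp hinput !addnS /= nth_cat szf ifN; last by lia.
  by rewrite -addnA addKn (nth_flatten_blocks (e0, e0)).
have fok : fields_ok E ord po tn inp (size E).
  move=> i iE /=; rewrite -[5 * i + 5]/(5 * i + 3.+2) -[5 * i + 6]/(5 * i + 4.+2) !inpf //=.
  have eE : nth e0 ord i \in E by rewrite -ordE mem_nth ?so.
  by split=> //; [exact: count_size|case: (hlt _ eE)].
have pok : pairs_ok ord rf inp (size E) (size rf).
  move=> j jrf /=; rewrite -[_ + 3]/(_ + 1.+2) !inpg //=.
  have [p1 p2 s1 s2 _] := proj2 hrf _ (mem_nth (e0, e0) jrf).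
  rewrite !ordE; split=> //; apply: contraNneq s2 => <-.
  by rewrite s1.
have tni : {in ord &, forall e f, (tn (thr e) == tn (thr f)) = (thr e == thr f)}.
  by move=> e e'; rewrite !ordE; exact: htn.
have inp_high : size rf + size rf = size E -> forall a, 2 + 6 * size E <= a -> inp a = 0.
  move=> hr a ha; rewrite /inp nth_default // hinput /= size_cat szf szg; lia.
have i0 : inp 0 = size E by rewrite /inp hinput.
have i1 : inp 1 = size rf by rewrite /inp hinput.
have HP := program_ok hE hrf hord tni erefl erefl i0 i1 inp_high fok pok erefl
  (leqnn (6 * size E)) (fun a _ => erefl (inp a)) erefl.
have rep : represents (init_mem input) [seq inp a | a <- iota 0 nreg] inp.
  by move=> a; case: ltnP => // an; rewrite (nth_map 0) ?size_iota // nth_iota.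
have [t [M [R [H [bt et rep' HQ]]]]] := wp_sound [::] [::] (erefl : wf_cmd program) rep HP.
rewrite cats0 /= in et.
exists t; split.
  by apply: leq_trans bt _; apply: leq_trans (cost_program _) _; rewrite mulnA leq_add.
rewrite /run et; split.
  (* The run ends just past the code, where the default of [nth] is [IHalt]. *)
  by rewrite /halted nth_default // size_compile.
by rewrite /accepts /= (rep' 0).
Qed.
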